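(* Let $M$ be a smooth oriented $3$-dimensional manifold with a smooth volume form $\Omega$, and let $X$ be a smooth divergence-free vector field on $(M,\Omega)$ that has a global cross-section. Then there exist a smooth manifold $\tilde M$ of dimension four and a symplectic $2$-form $\Lambda$ on $\tilde M$ such that: (1) $M$ is a smooth submanifold of $\tilde M$; (2) $X$ extends to a Hamiltonian vector field $\tilde X$ on $(\tilde M,\Lambda)$ (that is, $\tilde X|_M = X$) with a smooth Hamiltonian $H:\tilde M\to\mathbb{R}$, and $M=\{u\in\tilde M : H(u)=c\}$ for some $c\in\mathbb{R}$.
   Context: All objects are $C^\infty$. For a vector field $X$ on $(M,\Omega)$ the divergence is the function $\operatorname{div}X$ defined by $L_X\Omega=d(\imath_X\Omega)=(\operatorname{div}X)\,\Omega$; $X$ is divergence-free if $\operatorname{div}X\equiv 0$. A global cross-section of $X$ is a smooth closed (compact, without boundary) $2$-dimensional submanifold $N\subset M$ such that all orbits of $X$ intersect $N$, $X$ is transverse to $N$ at every point of $N$ (i.e. $X(m)\notin T_mN$ for $m\in N$), and each orbit starting on $N$ returns to $N$ in finite time. Then the Poincaré (first return) map $P:N\to N$ is a globally defined diffeomorphism and $M$ is diffeomorphic to the suspension over $P$, with roof function the return time. A vector field $\tilde X$ on a symplectic manifold $(\tilde M,\Lambda)$ is Hamiltonian with Hamiltonian $H$ if $\imath_{\tilde X}\Lambda=dH$. *)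

(* Defs.v *)
From HB Require Import structures.
From mathcomp Require Import all_boot all_order all_algebra.
From mathcomp Require Import all_classical all_reals all_analysis.

Set Implicit Arguments.
Unset Strict Implicit.
Unset Printing Implicit Defensive.

Import Order.TTheory GRing.Theory Num.Theory.
Import numFieldNormedType.Exports.

Local Open Scope classical_set_scope.
Local Open Scope ring_scope.

(* Manifolds are given by atlases, and tensor fields by families of local
   representatives related by the Jacobians of the coordinate changes. As in
   [derive.v] (['D_v f p = v *m jacobian f p]), vectors are rows and Jacobians
   act on the right. *)

Section smooth_functions.
Context {R : realType} {V W : normedModType R}.

Fixpoint Ck_on (U : set V) (k : nat) (f : V -> W) : Prop :=
  match k with
  | 0 => forall x, U x -> {for x, continuous f}
  | k'.+1 => (forall x, U x -> differentiable f x) /\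
             (forall v, Ck_on U k' ('D_v f))
  end.

(* Meant for open [U]. *)
Definition smooth_on (U : set V) (f : V -> W) : Prop := forall k, Ck_on U k f.

End smooth_functions.

(* [cmap] and [cinv] are junk outside [cdom] and [cmap @` cdom]. *)
Record chart (R : realType) (n : nat) (T : topologicalType) := Chart {
  cdom : set T;
  cmap : T -> 'rV[R]_n;
  cinv : 'rV[R]_n -> T;
  cdom_open : open cdom;
  ctarget_open : open (cmap @` cdom);
  cmapK : {in cdom, cancel cmap cinv};
  cmap_continuous : forall p, cdom p -> {for p, continuous cmap};
  cinv_continuous :
    forall x, (cmap @` cdom) x -> {for x, continuous cinv} }.

Definition ctarget (R : realType) n (T : topologicalType) (c : chart R n T) :
  set 'rV[R]_n := cmap c @` cdom c.

Definition transition (R : realType) n (T : topologicalType)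
  (c c' : chart R n T) : 'rV[R]_n -> 'rV[R]_n := cmap c' \o cinv c.

Definition compatible (R : realType) n (T : topologicalType)
  (c c' : chart R n T) : Prop :=
  smooth_on (cmap c @` (cdom c `&` cdom c')) (transition c c').

(* The atlas is not required to be maximal. *)
Record smooth_manifold (R : realType) (n : nat) := SmoothManifold {
  carrier :> topologicalType;
  atlas : set (chart R n carrier);
  atlas_cover : forall p, exists2 c, atlas c & cdom c p;
  atlas_compatible : forall c c', atlas c -> atlas c' -> compatible c c';
  manifold_hausdorff : hausdorff_space carrier;
  manifold_second_countable : @second_countable carrier }.
Arguments atlas {R n} s.

(* An orientation is given by an atlas with orientation-preserving coordinate
   changes; an oriented manifold is one presented by such an atlas. *)
Definition oriented (R : realType) n (M : smooth_manifold R n) : Prop :=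
  forall c c', atlas M c -> atlas M c' ->
  forall p, cdom c p -> cdom c' p ->
  0 < \det (jacobian (transition c c') (cmap c p)).

(* Membership in the maximal atlas. *)
Definition smooth_chart (R : realType) n (M : smooth_manifold R n)
  (c : chart R n M) : Prop :=
  forall c', atlas M c' -> compatible c c' /\ compatible c' c.

Section maps.
Context {R : realType}.

Definition local_map m n (M : smooth_manifold R m) (M' : smooth_manifold R n)
  (f : M -> M') (c : chart R m M) (c' : chart R n M') :
  'rV[R]_m -> 'rV[R]_n := cmap c' \o f \o cinv c.

Definition smooth_map m n (M : smooth_manifold R m) (M' : smooth_manifold R n)
  (f : M -> M') : Prop :=
  continuous f /\
  forall c c', atlas M c -> atlas M' c' ->
    smooth_on (cmap c @` (cdom c `&` f @^-1` cdom c')) (local_map f c c').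

Definition smooth_function n (M : smooth_manifold R n) (f : M -> R) : Prop :=
  forall c, atlas M c -> smooth_on (ctarget c) (f \o cinv c).

Definition immersion m n (M : smooth_manifold R m) (M' : smooth_manifold R n)
  (f : M -> M') : Prop :=
  smooth_map f /\
  forall c c', atlas M c -> atlas M' c' ->
  forall p, cdom c p -> cdom c' (f p) ->
  row_free (jacobian (local_map f c c') (cmap c p)).

(* The last clause says that [f] is a homeomorphism onto its range with the
   subspace topology. *)
Definition embedding m n (M : smooth_manifold R m) (M' : smooth_manifold R n)
  (f : M -> M') : Prop :=
  [/\ immersion f, injective f &
      forall U : set M, open U -> exists2 V : set M', open V & f @^-1` V = U].

End maps.

Section submanifolds.
Context {R : realType} {n : nat} (M : smooth_manifold R n).

Definition slice_chart (k : nat) (N : set M) (c : chart R n M) : Prop :=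
  smooth_chart c /\
  cmap c @` (cdom c `&` N) =
  ctarget c `&` [set x | forall i : 'I_n, (k <= i)%N -> x 0 i = 0].

Definition submanifold (k : nat) (N : set M) : Prop :=
  forall p, N p -> exists2 c, slice_chart k N c & cdom c p.

(* The tangent space of [N] at [p], read in the chart [a] around [p]. *)
Definition tangent_space (k : nat) (N : set M) (p : M) (a : chart R n M) :
  set 'rV[R]_n :=
  [set v | exists c, [/\ slice_chart k N c, cdom c p &
     forall i : 'I_n, (k <= i)%N ->
       (v *m jacobian (transition a c) (cmap a p)) 0 i = 0]].

End submanifolds.

(* [vf c x] is the coordinate vector in the chart [c], at the point with
   coordinates [x]; it is meaningful for [c] in the atlas and [x] in
   [ctarget c]. *)
Record vector_field (R : realType) n (M : smooth_manifold R n) := VectorField {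
  vf :> chart R n M -> 'rV[R]_n -> 'rV[R]_n;
  vf_transition : forall c c', atlas M c -> atlas M c' ->
    forall p, cdom c p -> cdom c' p ->
    vf c' (cmap c' p) = vf c (cmap c p) *m jacobian (transition c c') (cmap c p);
  vf_smooth : forall c, atlas M c -> smooth_on (ctarget c) (vf c) }.

(* Likewise for forms of degree [k], whose [k] arguments are the rows of a
   matrix. *)
Definition form_rep (R : realType) n (M : smooth_manifold R n) (k : nat) :=
  chart R n M -> 'rV[R]_n -> 'M[R]_(k, n) -> R.

Definition multilinear (R : realType) (k n : nat) (w : 'M[R]_(k, n) -> R) :=
  forall (A B C : 'M[R]_(k, n)) (i : 'I_k) (b c : R),
    row i A = b *: row i B + c *: row i C ->
    row' i B = row' i A -> row' i C = row' i A ->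
    w A = b * w B + c * w C.

Definition alternating (R : realType) (k n : nat) (w : 'M[R]_(k, n) -> R) :=
  forall (A : 'M[R]_(k, n)) (i j : 'I_k), i != j -> row i A = row j A -> w A = 0.

Record diff_form (R : realType) n (M : smooth_manifold R n) (k : nat) :=
  DiffForm {
  df :> form_rep M k;
  df_multilinear : forall c, atlas M c ->
    forall x, ctarget c x -> multilinear (df c x);
  df_alternating : forall c, atlas M c ->
    forall x, ctarget c x -> alternating (df c x);
  df_transition : forall c c', atlas M c -> atlas M c' ->
    forall p, cdom c p -> cdom c' p -> forall v : 'M[R]_(k, n),
    df c (cmap c p) v =
    df c' (cmap c' p) (v *m jacobian (transition c c') (cmap c p));
  df_smooth : forall c, atlas M c -> forall v : 'M[R]_(k, n),
    smooth_on (ctarget c) (fun x => df c x v) }.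

Section calculus.
Context {R : realType} {n : nat} {M : smooth_manifold R n}.

Definition form_eq k (w w' : form_rep M k) : Prop :=
  forall c, atlas M c -> forall x, ctarget c x -> forall v, w c x v = w' c x v.

Definition function_form (f : M -> R) : form_rep M 0 :=
  fun c x _ => f (cinv c x).

Definition function_mul k (f : M -> R) (w : form_rep M k) : form_rep M k :=
  fun c x v => f (cinv c x) * w c x v.

Definition interior_product k (X : vector_field M) (w : form_rep M k.+1) :
  form_rep M k := fun c x v => w c x (col_mx (X c x) v : 'M[R]_(1 + k, n)).

(* The invariant formula for the exterior derivative, evaluated in a chart on
   constant (hence commuting) vector fields. *)
Definition ext_derivative k (w : form_rep M k) : form_rep M k.+1 :=
  fun c x v => \sum_(i < k.+1)
    (-1) ^+ i * 'D_(row i v) (fun y => w c y (row' i v)) x.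

Definition volume_form (Omega : diff_form M n) : Prop :=
  forall c, atlas M c -> forall x, ctarget c x -> exists v, df Omega c x v != 0.

Definition closed_form k (w : form_rep M k) : Prop :=
  form_eq (ext_derivative w) (fun _ _ _ => 0).

Definition nondegenerate (w : form_rep M 2) : Prop :=
  forall c, atlas M c -> forall x, ctarget c x ->
  forall u : 'rV[R]_n,
    (forall v : 'rV[R]_n, w c x (col_mx u v : 'M[R]_(1 + 1, n)) = 0) -> u = 0.

Definition symplectic (w : diff_form M 2) : Prop :=
  closed_form w /\ nondegenerate w.

Definition hamiltonian (w : diff_form M 2) (X : vector_field M) (H : M -> R) :
  Prop := form_eq (interior_product X w) (ext_derivative (function_form H)).

(* Continuity keeps [g] inside a chart domain near [t], so that [cmap c \o g]
   is not junk there. *)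
Definition integral_curve (X : vector_field M) (I : set R) (g : R -> M) :
  Prop :=
  forall t, I t -> {for t, continuous g} /\
    forall c, atlas M c -> cdom c (g t) ->
      is_derive t (1 : R) (cmap c \o g) (X c (cmap c (g t))).

(* The local flow of [X] at time [t] is defined at [p] and sends it to [q]. *)
Definition flow (X : vector_field M) (t : R) (p q : M) : Prop :=
  exists (a b : R) (g : R -> M),
    [/\ a < 0 < b, a < t < b, integral_curve X `]a, b[ g, g 0 = p & g t = q].

Definition orbit (X : vector_field M) (p : M) : set M :=
  [set q | exists t, flow X t p q].

End calculus.

(* On forms of degree [k.+1 = n], [d (i_X Omega)] is the Lie derivative. *)
Definition is_divergence (R : realType) k (M : smooth_manifold R k.+1)
  (Omega : diff_form M k.+1) (X : vector_field M) (f : M -> R) : Prop :=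
  form_eq (ext_derivative (interior_product X Omega)) (function_mul f Omega).

Definition divergence_free (R : realType) k (M : smooth_manifold R k.+1)
  (Omega : diff_form M k.+1) (X : vector_field M) : Prop :=
  is_divergence Omega X (fun=> 0).

Record global_cross_section (R : realType) (M : smooth_manifold R 3)
  (X : vector_field M) (N : set M) : Prop := GlobalCrossSection {
  section_submanifold : submanifold 2 N;
  section_compact : compact N;
  section_orbit : forall p, orbit X p `&` N !=set0;
  section_transverse : forall p, N p ->
    forall a, atlas M a -> cdom a p -> ~ tangent_space 2 N p a (X a (cmap a p));
  section_return : forall p, N p ->
    exists t q, [/\ 0 < t, N q & flow X t p q] }.

(* [X'] restricts to [X] on the submanifold parametrised by [i]. *)
Definition extends (R : realType) m n (M : smooth_manifold R m)
  (M' : smooth_manifold R n) (i : M -> M') (X : vector_field M)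
  (X' : vector_field M') : Prop :=
  forall c c', atlas M c -> atlas M' c' ->
  forall p, cdom c p -> cdom c' (i p) ->
  X' c' (cmap c' (i p)) =
  X c (cmap c p) *m jacobian (local_map i c c') (cmap c p).

(* Main.v *)
(* Since X has a cross-section it has no zero: the orbit of a zero is a point,
   which would lie on the section, where X is transverse. Hence a partition of
   unity gives a 1-form alpha with alpha(X) = 1. On M x R, with s the second
   coordinate, put Lambda = i_X Omega - d(s alpha). It is closed because X is
   divergence-free. Along s = 0 it is nondegenerate, because the kernel of
   i_X Omega is spanned by X, and there i_X Lambda = ds. So Lambda is symplectic
   on the open set where it is nondegenerate, a neighbourhood of M x {0}, and
   the Hamiltonian vector field of s extends X. *)
Require Import Defs.
From HB Require Import structures.
From mathcomp Require Import all_boot all_order all_algebra.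
From mathcomp Require Import all_classical all_reals all_analysis.
From mathcomp Require Import ring lra.

Set Implicit Arguments.
Unset Strict Implicit.
Unset Printing Implicit Defensive.

Import Order.TTheory GRing.Theory Num.Theory.
Import numFieldNormedType.Exports.
Local Open Scope classical_set_scope.
Local Open Scope ring_scope.

(** * Smooth functions *)

Section smooth_calculus.
Context {R : realType}.
Implicit Types V W : normedModType R.

(** Forms exist only as families of chart representatives, and [ext_derivative] is a formula inside
    one chart. That [d(s alpha)] transforms as a form and is closed therefore rests on the symmetry
    of second derivatives, which is derived from the mean value theorem since smoothness is encoded
    by iterated directional derivatives. No flow is constructed: zeros of X are excluded by an a
    priori estimate on the integral curves that the orbits already provide. For alpha, each point
    has a function that increases along X nearby. The differentials of countably many of them are
    added with bump weights; the sum is positive on X, and it is divided by its value on X.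
    Nondegeneracy is measured by the determinant of the Gram matrix of Lambda in a lifted chart: its
    non-vanishing does not depend on the chart and is an open condition, and the inverse matrix
    yields the Hamiltonian field. The minus sign in front of [d(s alpha)] makes [i_X Lambda] equal
    to [ds] and not to its opposite along [s = 0]. *)

Lemma open_near (T : topologicalType) (U : set T) (x : T) (P : T -> Prop) :
  open U -> U x -> (forall y, U y -> P y) -> \forall y \near x, P y.
Proof.
move=> oU Ux UP; have : nbhs x U by exact: open_nbhs_nbhs.
by apply: filterS.
Qed.

(** A function that vanishes near [x] is its own remainder, so the zero map serves as its
    differential. Applied to a difference, this transports differentiability between functions that
    agree near [x]. *)
Lemma differentiable_near0 V W (r : V -> W) (x : V) :
  (\forall y \near x, r y = 0) -> differentiable r x.
Proof.
move=> r0; have rx : r x = 0 by exact: nbhs_singleton r0.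
have E : r \o shift x = cst (r x) + (\0 : V -> W) +o_ 0 id.
  apply/eqaddoP => _/posnumP[e].
  have : \forall h \near (0 : V), r (h + x) = 0.
    by move: r0; rewrite (near_shift 0) subr0.
  by apply: filterS => h /=; rewrite !fctE /= => ->; rewrite rx addr0 subr0 normr0.
have c0 : continuous (\0 : V -> W) by exact: cst_continuous.
apply/diff_locallyP.
by rewrite (diff_unique c0 E).
Qed.

Lemma differentiable_near_eq V W (f g : V -> W) (x : V) :
  (\forall y \near x, f y = g y) -> differentiable f x -> differentiable g x.
Proof.
move=> fg df; have -> : g = f + (g - f) by rewrite addrC subrK.
apply: differentiableD => //; apply: differentiable_near0.
by apply: filterS fg => y fgy; rewrite !fctE fgy subrr.
Qed.

Lemma Ck_on_mono V W (U U' : set V) k (f : V -> W) :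
  U' `<=` U -> Ck_on U k f -> Ck_on U' k f.
Proof.
move=> sU; elim: k f => [|k IH] f /=; first by move=> cf x /sU; exact: cf.
by move=> [df Df]; split=> [x /sU|v]; [exact: df|exact/IH/Df].
Qed.

Lemma Ck_on_local V W (U : set V) k (f : V -> W) :
  (forall x, U x -> exists2 U', U' x & Ck_on U' k f) -> Ck_on U k f.
Proof.
elim: k f => [|k IH] f Uf /=; first by move=> x /Uf[U' U'x]; apply.
split=> [x /Uf[U' U'x [dU' _]]|v]; first exact: dU'.
by apply: IH => x /Uf[U' U'x [_ Df]]; exists U' => //; exact: Df.
Qed.

Lemma Ck_on_eq V W (U : set V) k (f g : V -> W) :
  open U -> (forall x, U x -> f x = g x) -> Ck_on U k f -> Ck_on U k g.
Proof.
move=> oU; elim: k f g => [|k IH] f g fg /=.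
  move=> cf x Ux; have fgx : \forall y \near x, f y = g y by exact: open_near Ux fg.
  by apply: (cvg_trans (near_eq_cvg fgx)); rewrite -(fg x Ux); exact: cf.
move=> [df Df]; split=> [x Ux|v].
  by apply: differentiable_near_eq (df x Ux); exact: open_near Ux fg.
apply: (IH ('D_v f)) => // x Ux; apply: near_eq_derive; exact: open_near Ux fg.
Qed.

Lemma Ck_onW V W (U : set V) k (f : V -> W) : Ck_on U k.+1 f -> Ck_on U k f.
Proof.
elim: k f => [|k IH] f.
  by move=> [df _] x /df/differentiable_continuous.
by move=> [df Df]; split=> // v; apply: IH; exact: Df.
Qed.

Lemma Ck_on_cst V W (U : set V) k (a : W) : Ck_on U k (cst a : V -> W).
Proof.
elim: k a => [|k IH] a /=; first by move=> x _; exact: cvg_cst.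
split=> // v; rewrite (_ : 'D_v _ = cst 0); first exact: IH.
by apply/funext => x; rewrite derive_cst.
Qed.

Lemma Ck_onD V W (U : set V) k (f g : V -> W) : open U ->
  Ck_on U k f -> Ck_on U k g -> Ck_on U k (fun x => f x + g x).
Proof.
move=> oU; elim: k f g => [|k IH] f g /=.
  by move=> cf cg x Ux; apply: cvgD; [exact: cf|exact: cg].
move=> [df Df] [dg Dg]; split=> [x Ux|v].
  by apply: differentiableD; [exact: df|exact: dg].
apply: (@Ck_on_eq _ _ _ _ (fun x => 'D_v f x + 'D_v g x)) => // [x Ux|].
  by rewrite [RHS]deriveD//; apply: diff_derivable; [exact: df|exact: dg].
exact: IH.
Qed.

Lemma derive_linear_comp V W (W' : normedModType R) (L : {linear W -> W'})
    (f : V -> W) x v : continuous L -> differentiable f x ->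
  'D_v (L \o f) x = L ('D_v f x).
Proof.
move=> cL df; have dL : differentiable L (f x) by exact: linear_differentiable.
rewrite deriveE; last exact: differentiable_comp.
by rewrite diff_comp//= diff_lin// deriveE.
Qed.

Lemma Ck_on_linear_comp V W (W' : normedModType R) (U : set V) k
    (L : {linear W -> W'}) (f : V -> W) : open U -> continuous L ->
  Ck_on U k f -> Ck_on U k (L \o f).
Proof.
move=> oU cL; elim: k f => [|k IH] f /=.
  by move=> cf x Ux; apply: continuous_comp; [exact: cf|exact: cL].
move=> [df Df]; split=> [x Ux|v].
  by apply: differentiable_comp; [exact: df|exact: linear_differentiable].
apply: (@Ck_on_eq _ _ _ _ (L \o 'D_v f)) => // [x Ux|]; last exact/IH/Df.
by rewrite derive_linear_comp//; exact: df.
Qed.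

Lemma Ck_onM V (U : set V) k (f g : V -> R) : open U ->
  Ck_on U k f -> Ck_on U k g -> Ck_on U k (fun x => f x * g x).
Proof.
move=> oU; elim: k f g => [|k IH] f g /=.
  by move=> cf cg x Ux; apply: cvgM; [exact: cf|exact: cg].
move=> Cf Cg; have [df Df] := Cf; have [dg Dg] := Cg; split=> [x Ux|v].
  by apply: differentiableM; [exact: df|exact: dg].
apply: (@Ck_on_eq _ _ _ _ (fun x => f x * 'D_v g x + g x * 'D_v f x)) => // [x Ux|].
  by rewrite [RHS]deriveM//; apply: diff_derivable; [exact: df|exact: dg].
by apply: Ck_onD => //; apply: IH => //; exact: Ck_onW.
Qed.

(** The derivative of [1 / f] is a product of [1 / f], again [1 / f] and the derivative of [f], so
    regularity of [1 / f] itself at one order less is all that the induction needs. *)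
Lemma Ck_on_inv V (U : set V) k (f : V -> R) : open U ->
  (forall x, U x -> f x != 0) -> Ck_on U k f -> Ck_on U k (fun x => (f x)^-1).
Proof.
move=> oU f0; elim: k => [|k IH] /=.
  by move=> cf x Ux; apply: cvgV; [exact: f0|exact: cf].
move=> Cf; have [df Df] := Cf; split=> [x Ux|v].
  by apply: differentiableV; [exact: df|exact: f0].
apply: (@Ck_on_eq _ _ _ _
  (fun x => - 1 * ((f x)^-1 * ((f x)^-1 * 'D_v f x)))) => // [x Ux|].
  rewrite [RHS]deriveV ?f0//; last exact/diff_derivable/df.
  by rewrite mulN1r mulrA -expr2 exprVn -mulNr.
apply: Ck_onM => //; first exact: Ck_on_cst.
have CfW : Ck_on U k f by exact: Ck_onW.
by do 2!(apply: Ck_onM => //; first exact: IH).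
Qed.

Lemma Ck_on_linear V W (U : set V) k (f : {linear V -> W}) :
  continuous f -> Ck_on U k f.
Proof.
move=> cf; case: k => [|k] /=; first by move=> x _; exact: cf.
split=> [x _|v]; first exact: linear_differentiable.
rewrite (_ : 'D_v _ = cst (f v)); first exact: Ck_on_cst.
by apply/funext => x; rewrite deriveE ?diff_lin//; exact: linear_differentiable.
Qed.

Lemma smooth_on_derive V W (U : set V) (f : V -> W) v :
  smooth_on U f -> smooth_on U ('D_v f).
Proof. by move=> Sf k; have [_] := Sf k.+1; apply. Qed.

Lemma smooth_on_differentiable V W (U : set V) (f : V -> W) x :
  smooth_on U f -> U x -> differentiable f x.
Proof. by move=> Sf; have [+ _] := Sf 1%N; apply. Qed.

Lemma smooth_on_continuous V W (U : set V) (f : V -> W) x :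
  smooth_on U f -> U x -> {for x, continuous f}.
Proof. by move=> Sf; have := Sf 0%N; apply. Qed.

Lemma smooth_on_mono V W (U U' : set V) (f : V -> W) :
  U' `<=` U -> smooth_on U f -> smooth_on U' f.
Proof. by move=> sU Sf k; exact: Ck_on_mono (Sf k). Qed.

Lemma smooth_on_local V W (U : set V) (f : V -> W) :
  (forall x, U x -> exists2 U', U' x & smooth_on U' f) -> smooth_on U f.
Proof.
by move=> Uf k; apply: Ck_on_local => x /Uf[U' U'x Sf]; exists U'.
Qed.

Lemma smooth_on_eq V W (U : set V) (f g : V -> W) :
  open U -> (forall x, U x -> f x = g x) -> smooth_on U f -> smooth_on U g.
Proof. by move=> oU fg Sf k; exact: Ck_on_eq (Sf k). Qed.

Lemma smooth_on_cst V W (U : set V) (a : W) : smooth_on U (fun=> a : W).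
Proof. move=> k; exact: Ck_on_cst. Qed.

Lemma smooth_onD V W (U : set V) (f g : V -> W) : open U ->
  smooth_on U f -> smooth_on U g -> smooth_on U (fun x => f x + g x).
Proof. by move=> oU Sf Sg k; exact: Ck_onD. Qed.

Lemma smooth_on_linear_comp V W (W' : normedModType R) (U : set V)
    (L : {linear W -> W'}) (f : V -> W) : open U -> continuous L ->
  smooth_on U f -> smooth_on U (L \o f).
Proof. by move=> oU cL Sf k; exact: Ck_on_linear_comp. Qed.

Lemma smooth_onM V (U : set V) (f g : V -> R) : open U ->
  smooth_on U f -> smooth_on U g -> smooth_on U (fun x => f x * g x).
Proof. by move=> oU Sf Sg k; exact: Ck_onM. Qed.

Lemma smooth_onN V W (U : set V) (f : V -> W) : open U ->
  smooth_on U f -> smooth_on U (fun x => - f x).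
Proof.
by move=> oU Sf; apply: (smooth_on_linear_comp (L := -%R)) => //; exact: opp_continuous.
Qed.

Lemma smooth_on_Zl V W (U : set V) (f : V -> R) (w : W) : open U ->
  smooth_on U f -> smooth_on U (fun x => f x *: w).
Proof.
move=> oU Sf.
have sl : linear ( *:%R ^~ w : R -> _) by move=> u y z; rewrite scalerDl scalerA.
pose slM := GRing.isLinear.Build _ _ _ _ _ sl.
pose sL : {linear _ -> _} := HB.pack ( *:%R ^~ w) slM.
by apply: (smooth_on_linear_comp (L := sL)) => //; exact: scalel_continuous.
Qed.

Lemma smooth_onB V W (U : set V) (f g : V -> W) : open U ->
  smooth_on U f -> smooth_on U g -> smooth_on U (fun x => f x - g x).
Proof. by move=> oU Sf Sg; apply: smooth_onD => //; exact: smooth_onN. Qed.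

Lemma smooth_onV V (U : set V) (f : V -> R) : open U ->
  (forall x, U x -> f x != 0) -> smooth_on U f ->
  smooth_on U (fun x => (f x)^-1).
Proof. by move=> oU f0 Sf k; exact: Ck_on_inv. Qed.

Lemma smooth_on_sum V W (U : set V) (I : Type) (r : seq I) (P : pred I)
    (F : I -> V -> W) : open U -> (forall i, P i -> smooth_on U (F i)) ->
  smooth_on U (fun x => \sum_(i <- r | P i) F i x).
Proof.
move=> oU SF; elim: r => [|i r IH].
  apply: (@smooth_on_eq _ _ _ (fun=> 0)) => // [x _|]; first by rewrite big_nil.
  exact: smooth_on_cst.
apply: (@smooth_on_eq _ _ _ (fun x => if P i then F i x + \sum_(j <- r | P j) F j x
    else \sum_(j <- r | P j) F j x)) => // [x _|]; first by rewrite big_cons.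
by case Pi : (P i) => //; apply: smooth_onD => //; exact: SF.
Qed.

Lemma smooth_on_prod V (U : set V) (I : Type) (r : seq I) (P : pred I)
    (F : I -> V -> R) : open U -> (forall i, P i -> smooth_on U (F i)) ->
  smooth_on U (fun x => \prod_(i <- r | P i) F i x).
Proof.
move=> oU SF; elim: r => [|i r IH].
  apply: (@smooth_on_eq V R _ (fun=> 1)) => // [x _|]; first by rewrite big_nil.
  exact: smooth_on_cst.
apply: (@smooth_on_eq V R _ (fun x => if P i then F i x * \prod_(j <- r | P j) F j x
    else \prod_(j <- r | P j) F j x)) => // [x _|]; first by rewrite big_cons.
by case Pi : (P i) => //; apply: smooth_onM => //; exact: SF.
Qed.

Lemma smooth_on_linear V W (U : set V) (f : {linear V -> W}) :
  continuous f -> smooth_on U f.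
Proof. by move=> cf k; exact: Ck_on_linear. Qed.

Lemma smooth_on_id V (U : set V) : smooth_on U (fun x : V => x).
Proof. by apply: (@smooth_on_linear _ _ _ idfun) => x; exact: cvg_id. Qed.

Lemma smooth_on_det V (U : set V) n (A : V -> 'M[R]_n) : open U ->
  (forall i j, smooth_on U (fun x => A x i j)) ->
  smooth_on U (fun x => \det (A x)).
Proof.
move=> oU SA; apply: smooth_on_sum => // s _.
apply: smooth_onM => //; first exact: smooth_on_cst.
exact: smooth_on_prod.
Qed.

Lemma smooth_on_coord V (U : set V) m n (f : V -> 'M[R]_(m, n)) i j : open U ->
  smooth_on U f -> smooth_on U (fun x => f x i j).
Proof.
move=> oU Sf.
have @L : {linear 'M[R]_(m, n) -> R}.
  by exists (fun N : 'M[R]_(_, _) => N i j); do 2![eexists]; do ?[constructor];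
     rewrite ?mxE// => ? *; rewrite ?mxE//; move=> ?; rewrite !mxE.
by apply: (smooth_on_linear_comp (L := L)) => //; exact: coord_continuous.
Qed.

Lemma smooth_on_rV V (U : set V) n (f : V -> 'rV[R]_n) : open U ->
  (forall j, smooth_on U (fun x => f x 0 j)) -> smooth_on U f.
Proof.
move=> oU Sf.
apply: (@smooth_on_eq _ _ _ (fun x => \sum_j f x 0 j *: delta_mx 0 j)) => //.
  by move=> x _; rewrite [RHS]row_sum_delta.
by apply: smooth_on_sum => // j _; exact: smooth_on_Zl.
Qed.

Lemma derive_comp m V W (f : V -> 'rV[R]_m) (g : 'rV[R]_m -> W) x v :
  differentiable f x -> differentiable g (f x) ->
  'D_v (g \o f) x = 'D_('D_v f x) g (f x).
Proof.
move=> df dg; rewrite deriveE; last exact: differentiable_comp.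
by rewrite diff_comp//= -(deriveE _ df) -(deriveE _ dg).
Qed.

Lemma derive_sum_delta m W (g : 'rV[R]_m -> W) x v : differentiable g x ->
  'D_v g x = \sum_j v 0 j *: 'D_(delta_mx 0 j) g x.
Proof.
move=> dg; rewrite deriveE// {1}(row_sum_delta v) linear_sum.
by apply: eq_bigr => j _; rewrite linearZ/= deriveE.
Qed.

(** Induction on [k] with [f] fixed: the chain rule writes a derivative of [g \o f] through the
    functions ['D_(delta_mx 0 j) g \o f], to which the induction hypothesis applies. Assuming [f]
    and [g] smooth to all orders avoids any bookkeeping of orders. *)
Lemma Ck_on_comp m V (U : set V) (U' : set 'rV[R]_m) k (f : V -> 'rV[R]_m)
    (g : 'rV[R]_m -> R) : open U -> (forall x, U x -> U' (f x)) ->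
  smooth_on U f -> smooth_on U' g -> Ck_on U k (g \o f).
Proof.
move=> oU fU Sf; elim: k g => [|k IH] g Sg /=.
  move=> x Ux; apply: continuous_comp; first exact: smooth_on_continuous Sf Ux.
  by apply: smooth_on_continuous Sg _; exact: fU.
have df x (Ux : U x) := smooth_on_differentiable Sf Ux.
have dg x (Ux : U x) := smooth_on_differentiable Sg (fU _ Ux).
split=> [x Ux|v]; first by apply: differentiable_comp; [exact: df|exact: dg].
apply: (@Ck_on_eq _ _ _ _
  (fun x => \sum_j 'D_v f x 0 j * ('D_(delta_mx 0 j) g \o f) x)) => // [x Ux|].
  rewrite derive_comp//; [|exact: df|exact: dg].
  by rewrite [RHS]derive_sum_delta//; exact: dg.
have SM k' j : Ck_on U k' (fun x => 'D_v f x 0 j).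
  by apply: smooth_on_coord => //; exact: smooth_on_derive.
elim: (index_enum _) => [|j r IHr].
  by apply: (Ck_on_eq oU _ (Ck_on_cst U k 0)) => x _; rewrite big_nil.
apply: (Ck_on_eq oU (f := fun x => 'D_v f x 0 j * ('D_(delta_mx 0 j) g \o f) x +
   \sum_(j <- r) 'D_v f x 0 j * ('D_(delta_mx 0 j) g \o f) x)).
  by move=> x _; rewrite big_cons.
by apply: Ck_onD => //; apply: Ck_onM => //; apply: IH; exact: smooth_on_derive.
Qed.

Lemma smooth_on_comp m V (U : set V) (U' : set 'rV[R]_m) (f : V -> 'rV[R]_m)
    (g : 'rV[R]_m -> R) : open U -> (forall x, U x -> U' (f x)) ->
  smooth_on U f -> smooth_on U' g -> smooth_on U (g \o f).
Proof. by move=> oU fU Sf Sg k; exact: Ck_on_comp Sg. Qed.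

Lemma smooth_on_comp_rV m n V (U : set V) (U' : set 'rV[R]_m)
    (f : V -> 'rV[R]_m) (g : 'rV[R]_m -> 'rV[R]_n) : open U -> open U' ->
  (forall x, U x -> U' (f x)) ->
  smooth_on U f -> smooth_on U' g -> smooth_on U (g \o f).
Proof.
move=> oU oU' fU Sf Sg; apply: smooth_on_rV => // j.
by apply: (smooth_on_comp oU fU Sf (g := fun y => g y 0 j)); exact: smooth_on_coord.
Qed.

(** The cutoffs below live on [R], which is not a space of rows; hence a second chain rule. *)
Lemma Ck_on_comp1 V (U : set V) k (f : V -> R) (g : R -> R) :
  open U -> smooth_on U f -> smooth_on setT g -> Ck_on U k (g \o f).
Proof.
move=> oU Sf; elim: k g => [|k IH] g Sg /=.
  move=> x Ux; apply: continuous_comp; first exact: smooth_on_continuous Sf Ux.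
  exact: smooth_on_continuous Sg _.
have df x (Ux : U x) := smooth_on_differentiable Sf Ux.
have dg y := smooth_on_differentiable Sg (I : setT y).
split=> [x Ux|v]; first by apply: differentiable_comp; [exact: df|exact: dg].
apply: (@Ck_on_eq _ _ _ _ (fun x => 'D_v f x * ('D_1 g \o f) x)) => // [x Ux|].
  have [dfx dgx] := (df x Ux, dg (f x)).
  rewrite [RHS]deriveE; last exact: differentiable_comp.
  rewrite diff_comp//= (deriveE v dfx) (deriveE (1 : R) dgx).
  by rewrite -[in RHS](mulr1 ('d f x v)) [RHS]linearZ.
apply: Ck_onM => //; first exact: smooth_on_derive.
by apply: IH; exact: smooth_on_derive.
Qed.

Lemma smooth_on_comp1 V (U : set V) (f : V -> R) (g : R -> R) :
  open U -> smooth_on U f -> smooth_on setT g -> smooth_on U (g \o f).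
Proof. by move=> oU Sf Sg k; exact: Ck_on_comp1. Qed.

End smooth_calculus.

(** * Symmetry of second derivatives *)

Section schwarz.
Context {R : realType} {V : normedModType R}.
Implicit Types (f : V -> R) (x u v : V).

Lemma is_derive_line (W : normedModType R) (f : V -> W) x u (s : R) :
  differentiable f (x + s *: u) ->
  is_derive s (1 : R) (fun t : R => f (x + t *: u)) ('D_u f (x + s *: u)).
Proof.
move=> df; have dl : is_diff s (fun t : R => x + t *: u) ( *:%R ^~ u).
  by apply: (@is_diff_eq _ _ _ _ (0 + ( *:%R ^~ u))); rewrite add0r.
have dc : differentiable (f \o (fun t : R => x + t *: u)) s.
  exact: differentiable_comp.
apply: DeriveDef; first exact: diff_derivable.
rewrite deriveE; last exact: dc.
by rewrite diff_comp//= diff_val scale1r deriveE.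
Qed.

Lemma MVT_line f x u (h : R) : 0 < h ->
  (forall s, 0 <= s <= h -> differentiable f (x + s *: u)) ->
  exists2 s, 0 < s < h & f (x + h *: u) - f x = 'D_u f (x + s *: u) * h.
Proof.
move=> h0 df.
have dl s : 0 <= s <= h ->
    is_derive s (1 : R) (fun t : R => f (x + t *: u)) ('D_u f (x + s *: u)).
  by move=> /df; exact: is_derive_line.
have [] := @MVT R (fun t : R => f (x + t *: u))
  (fun s => 'D_u f (x + s *: u)) 0 h h0.
- by move=> s; rewrite in_itv/= => /andP[s0 sh]; apply: dl; rewrite !ltW.
- apply: derivable_within_continuous => s; rewrite in_itv/= => /dl sh.
  exact: ex_derive.
- by move=> s; rewrite in_itv/= scale0r addr0 subr0 => sh ->; exists s.
Qed.

(** The mean value theorem is applied to the increment in direction [v] as a function of the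
    position along [u], then to ['D_u f] along [v]. The second difference on the left is symmetric
    in [u] and [v], the right-hand side is not visibly so. *)
Lemma mixed_difference f (U : set V) x u v (h : R) : open U -> smooth_on U f ->
  0 < h ->
  (forall s t : R, 0 <= s <= h -> 0 <= t <= h -> U (x + s *: u + t *: v)) ->
  exists s t : R, [/\ 0 < s < h, 0 < t < h &
    f (x + h *: u + h *: v) - f (x + h *: u) - (f (x + h *: v) - f x) =
    'D_v ('D_u f) (x + s *: u + t *: v) * h * h].
Proof.
move=> oU Sf h0 Uh.
have hh : 0 <= h <= h by apply/andP; split; [exact: ltW|exact: lexx].
have zh : 0 <= (0 : R) <= h by apply/andP; split; [exact: lexx|exact: ltW].
have df := smooth_on_differentiable Sf.
have Us s : 0 <= s <= h -> U (x + s *: u).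
  by move=> sh; have := Uh s 0 sh zh; rewrite scale0r addr0.
have dl s : 0 <= s <= h -> is_derive s (1 : R)
    (fun t : R => f (x + h *: v + t *: u) - f (x + t *: u))
    ('D_u f (x + s *: u + h *: v) - 'D_u f (x + s *: u)).
  move=> sh; rewrite [X in 'D_u f X - _]addrAC.
  have d1 := is_derive_line (df _ (Us _ sh)).
  have /df/is_derive_line d2 : U (x + h *: v + s *: u) by rewrite addrAC; exact: Uh.
  exact: (is_deriveB d2 d1).
have [] := @MVT R (fun t : R => f (x + h *: v + t *: u) - f (x + t *: u))
  (fun s => 'D_u f (x + s *: u + h *: v) - 'D_u f (x + s *: u)) 0 h h0.
- by move=> s; rewrite in_itv/= => /andP[s0 sh]; apply: dl; rewrite !ltW.
- apply: derivable_within_continuous => s; rewrite in_itv/= => /dl sh.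
  exact: ex_derive.
move=> s; rewrite in_itv/= => /[dup] sh /andP[s0 s1].
rewrite !scale0r !addr0 subr0 => E1.
have sh' : 0 <= s <= h by rewrite !ltW.
have [] := @MVT_line ('D_u f) (x + s *: u) v h h0.
  move=> t th; apply: (smooth_on_differentiable (smooth_on_derive u Sf)).
  exact: Uh.
move=> t th E2; exists s, t; split=> //.
by rewrite -E2 -E1 (addrAC x (h *: u)).
Qed.

(* Both mixed derivatives are the limit of the second difference over [h ^+ 2]. *)
Lemma schwarz f (U : set V) x u v : open U -> U x -> smooth_on U f ->
  'D_v ('D_u f) x = 'D_u ('D_v f) x.
Proof.
move=> oU Ux Sf.
have cA := smooth_on_continuous (smooth_on_derive v (smooth_on_derive u Sf)) Ux.
have cB := smooth_on_continuous (smooth_on_derive u (smooth_on_derive v Sf)) Ux.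
apply/eqP; rewrite -subr_eq0 -normr_le0; apply/ler_addgt0Pr => e e0.
rewrite add0r.
have e2 : 0 < e / 2 by rewrite divr_gt0.
have : \forall y \near x, [/\ U y,
    `|'D_v ('D_u f) x - 'D_v ('D_u f) y| < e / 2 &
    `|'D_u ('D_v f) x - 'D_u ('D_v f) y| < e / 2].
  have n1 : nbhs x U by exact: open_nbhs_nbhs.
  have /cvgrPdist_lt/(_ _ e2) n2 := cA.
  have /cvgrPdist_lt/(_ _ e2) n3 := cB.

  have FF : Filter (nbhs x) := nbhs_filter x.
  apply: filterS (filterI n1 (filterI n2 n3)) => y [Uy [Ay By]].
  by split; [exact: Uy|exact: Ay|exact: By].
move=> /nbhs_ballP[r /= r0 br].
(* With this [h] the whole parallelogram spanned by [h *: u] and [h *: v] stays in the ball; the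
   summand 1 keeps the denominator positive when both vectors are zero. *)
pose h := r / (`|u| + `|v| + 1).
have d0 : 0 < `|u| + `|v| + 1 by rewrite ltr_wpDl// addr_ge0.
have h0 : 0 < h by rewrite divr_gt0.
have bh s t : 0 <= s <= h -> 0 <= t <= h -> ball x r (x + s *: u + t *: v).
  move=> /andP[s0 s1] /andP[t0 t1].
  rewrite -ball_normE/= -addrA opprD addrA subrr add0r normrN.
  rewrite (le_lt_trans (ler_normD _ _))// !normrZ !ger0_norm//.
  rewrite (@le_lt_trans _ _ (h * (`|u| + `|v|)))//.
    by rewrite mulrDr lerD// ler_wpM2r.
  by rewrite -[ltRHS](divfK (lt0r_neq0 d0)) ltr_pM2l// ltrDl.
have [s1 [t1 [/andP[s10 s1h] /andP[t10 t1h] E1]]] := @mixed_difference f U x u v h oU Sf h0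
  (fun s t sh th => let: And3 p _ _ := br _ (bh s t sh th) in p).
have bh' s t : 0 <= s <= h -> 0 <= t <= h -> ball x r (x + s *: v + t *: u).
  by move=> sh th; rewrite addrAC; exact: bh.
have [s2 [t2 [/andP[s20 s2h] /andP[t20 t2h] E2]]] := @mixed_difference f U x v u h oU Sf h0
  (fun s t sh th => let: And3 p _ _ := br _ (bh' s t sh th) in p).
(* The two second differences are equal, and [h * h] can be cancelled. *)
have EE : 'D_v ('D_u f) (x + s1 *: u + t1 *: v) =
          'D_u ('D_v f) (x + s2 *: v + t2 *: u).
  apply: (mulIf (lt0r_neq0 h0)); apply: (mulIf (lt0r_neq0 h0)).
  have swap (a p q d : R) : a - p - (q - d) = a - q - (p - d) by ring.
  apply: (etrans (esym E1)); apply: (etrans _ E2).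
  by rewrite (addrAC x (h *: v)); exact: swap.
have [_ A1 _] := br _ (bh s1 t1 ltac:(by rewrite !ltW) ltac:(by rewrite !ltW)).
have [_ _ B2] := br _ (bh' s2 t2 ltac:(by rewrite !ltW) ltac:(by rewrite !ltW)).
move: A1 B2; rewrite EE.
move: ('D_v _ x) ('D_u _ x) ('D_u ('D_v f) _) => a b c A1 B2.
apply: (le_trans (ler_distD c a b)); rewrite (splitr e).
by apply: lerD; [exact: ltW|rewrite distrC; exact: ltW].
Qed.

End schwarz.

Lemma derive_coord (R : realType) (V : normedModType R) m n
    (f : V -> 'M[R]_(m, n)) x v i j : differentiable f x ->
  ('D_v f x) i j = 'D_v (fun y => f y i j) x.
Proof. by move=> df; rewrite derive_mx ?mxE//; exact: diff_derivable. Qed.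

(** * Bump functions *)

Section bump.
Context {R : realType}.

Definition flat (n : nat) (x : R) : R :=
  if 0 < x then x^-1 ^+ n * expR (- x^-1) else 0.

Lemma flat_ge0 n x : 0 <= flat n x.
Proof.
rewrite /flat; case: ifP => // x0.
by rewrite mulr_ge0 ?expR_ge0// exprn_ge0// invr_ge0 ltW.
Qed.

(** A single term of the exponential series bounds [expR x^-1] from below. Used at [n.+1], the
    estimate controls the difference quotient of [flat n] at 0. *)
Lemma flat_le n x : 0 < x -> flat n x <= (n.+1)`!%:R * x.
Proof.
move=> x0; rewrite /flat x0 expRN.
have y0 : 0 < x^-1 by rewrite invr_gt0.
have f0 : 0 < (n.+1)`!%:R :> R by rewrite ltr0n fact_gt0.
have le1 : x^-1 ^+ n.+1 / (n.+1)`!%:R <= expR x^-1.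
  by apply: le_trans (expR_ge1Dxn n (ltW y0)); rewrite lerDr.
rewrite ler_pdivrMr ?expR_gt0// mulrAC -ler_pdivrMr// -exprSr mulrC.
by rewrite -ler_pdivrMr.
Qed.

(* The family of all [flat n] is needed because its span is closed under
   differentiation. *)
Lemma is_derive_flat n x :
  is_derive x (1 : R) (flat n) (- n%:R * flat n.+1 x + flat n.+2 x).
Proof.
have [x0|x0|->] := ltgtP x 0.
- have -> : - n%:R * flat n.+1 x + flat n.+2 x = 0.
    by rewrite /flat ltNge ltW//= mulr0 addr0.
  apply: (@near_eq_is_derive _ _ _ (cst 0)).
  have : \forall y \near x, y < 0 by exact: lt_nbhsl.
  by apply: filterS => y y0; rewrite /flat ltNge ltW.
- apply: (@near_eq_is_derive _ _ _ (fun y : R => y^-1 ^+ n * expR (- y^-1))).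
    have : \forall y \near x, 0 < y by exact: lt_nbhsr.
    by apply: filterS => y y0; rewrite /flat y0.
  have xn0 : x != 0 by rewrite gt_eqF.
  have dV : is_derive x (1 : R) (fun y : R => y^-1) (- x ^- 2 *: 1).
    exact: (@is_deriveV R id).
  have dX := is_deriveX n dV; rewrite exprfctE in dX.
  have dN : is_derive x (1 : R) (fun y : R => - y^-1) _ := is_deriveN dV.
  have dE : is_derive x (1 : R) (expR \o (fun y : R => - y^-1)) _ :=
    is_derive1_comp (is_derive_expR _) dN.
  have dM : is_derive x (1 : R) (fun y : R => y^-1 ^+ n * expR (- y^-1)) _ :=
    is_deriveM dX dE.
  apply: (is_derive_eq dM); rewrite /flat x0 /GRing.scale/= mulr1.
  clear; move: (expR _) => e; rewrite -exprVn; move: x^-1 => y.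
  by case: n => [|n] /=; rewrite ?expr0 ?exprS; ring.
- have -> : - n%:R * flat n.+1 0 + flat n.+2 0 = 0.
    by rewrite /flat ltxx mulr0 addr0.
  (* To the right of 0 the difference quotient of [flat n] at 0 is exactly [flat n.+1], which has a
     linear bound; to the left it is 0. *)
  have q h : h != 0 ->
      `|h^-1 *: ((flat n \o shift 0) (h *: 1) - flat n 0)| <= (n.+2)`!%:R * `|h|.
    move=> h0; have -> : (flat n \o shift 0) (h *: 1) = flat n h.
      by rewrite /= addr0 [h *: _]mulr1.
    have -> : flat n 0 = 0 by rewrite /flat ltxx.
    rewrite subr0.
    have [hp|hn] := ltP 0 h.
      have -> : h^-1 *: flat n h = flat n.+1 h.
        by rewrite /flat hp exprS -mulrA.
      by rewrite ger0_norm ?flat_ge0// gtr0_norm// flat_le.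
    by rewrite /flat ltNge hn/= scaler0 normr0 mulr_ge0.
  have c : (fun h => h^-1 *: ((flat n \o shift 0) (h *: 1) - flat n 0)) @ 0^'
      --> (0 : R).
    have F0 : 0 < (n.+2)`!%:R :> R by rewrite ltr0n fact_gt0.
    apply/cvgrPdist_le => e e0; near=> h; rewrite sub0r normrN.
    have h0 : h != 0 by near: h; exact: nbhs_dnbhs_neq.
    apply: (le_trans (q h h0)); rewrite mulrC -ler_pdivlMr//.
    by near: h; apply: dnbhs0_le; rewrite divr_gt0.
  by apply: DeriveDef; [apply/cvg_ex; exists 0|exact: cvg_lim c].
Unshelve. all: by end_near. Qed.

Lemma smooth_on_flat n : smooth_on setT (flat n).
Proof.
move=> k; elim: k n => [|k IH] n.
  move=> x _; apply/differentiable_continuous/derivable1_diffP.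
  by have [] := is_derive_flat n x.
have df x : differentiable (flat n) x.
  by apply/derivable1_diffP; have [] := is_derive_flat n x.
split=> // v.
apply: (@Ck_on_eq _ _ _ _ _ (fun x => v * (- n%:R * flat n.+1 x + flat n.+2 x))).
- exact: openT.
- move=> x _; have [_ <-] := is_derive_flat n x.
  by rewrite !deriveE// -[in RHS](mulr1 v) [RHS]linearZ.
- apply: Ck_onM; [exact: openT|exact: Ck_on_cst|].
  apply: Ck_onD; [exact: openT| |exact: IH].
  by apply: Ck_onM; [exact: openT|exact: Ck_on_cst|exact: IH].
Qed.

Definition cutoff (t : R) : R := flat 0 (2 - t) / (flat 0 (2 - t) + flat 0 (t - 1)).

(** The numbers [2 - t] and [t - 1] add up to 1, so at least one of them is positive. *)
Lemma cutoff_den t : 0 < flat 0 (2 - t) + flat 0 (t - 1).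
Proof.
have f0 x : 0 < x -> 0 < flat 0 x by move=> x0; rewrite /flat x0 expr0 mul1r expR_gt0.
have [t1|t1] := ltP 1 t.
  by apply: ltr_wpDl; [exact: flat_ge0|apply: f0; rewrite subr_gt0].
by apply: ltr_pwDl; [apply: f0; lra|exact: flat_ge0].
Qed.

Lemma cutoff1 t : t <= 1 -> cutoff t = 1.
Proof.
move=> t1; have := cutoff_den t; rewrite /cutoff.
have -> : flat 0 (t - 1) = 0 by rewrite /flat ltNge subr_le0 t1.
rewrite addr0.
by move=> f0; rewrite divff// gt_eqF.
Qed.

Lemma cutoff0 t : 2 <= t -> cutoff t = 0.
Proof.
by move=> t2; rewrite /cutoff {1}/flat ltNge subr_le0 t2 mul0r.
Qed.

Lemma cutoff_itv t : 0 <= cutoff t <= 1.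
Proof.
rewrite /cutoff divr_ge0 ?flat_ge0 ?(ltW (cutoff_den _))//=.
by rewrite ler_pdivrMr ?cutoff_den// mul1r lerDl flat_ge0.
Qed.

Lemma smooth_on_cutoff : smooth_on setT cutoff.
Proof.
have oT : open [set: R] by exact: openT.
have sid : smooth_on setT (fun t : R => t) by exact: smooth_on_id.
have s1 : smooth_on setT (fun t : R => flat 0 (2 - t)).
  apply: (smooth_on_comp1 (f := fun t : R => 2 - t)) => //; last exact: smooth_on_flat.
  by apply: smooth_onB => //; exact: smooth_on_cst.
have s2 : smooth_on setT (fun t : R => flat 0 (t - 1)).
  apply: (smooth_on_comp1 (f := fun t : R => t - 1)) => //; last exact: smooth_on_flat.
  by apply: smooth_onB => //; exact: smooth_on_cst.
apply: smooth_onM => //; apply: smooth_onV => //; last exact: smooth_onD.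
by move=> x _; rewrite gt_eqF// cutoff_den.
Qed.

Lemma smooth_on_sqdist n (U : set 'rV[R]_n) (a : 'rV[R]_n) : open U ->
  smooth_on U (fun x => \sum_i (x 0 i - a 0 i) ^+ 2).
Proof.
move=> oU; apply: smooth_on_sum => // i _.
have s : smooth_on U (fun x : 'rV[R]_n => x 0 i - a 0 i).
  apply: smooth_onB => //; last exact: smooth_on_cst.
  apply: smooth_on_coord => //.
  exact: smooth_on_id.
by apply: (smooth_onM oU s s).
Qed.

Lemma rV_bump n (a : 'rV[R]_n) (U : set 'rV[R]_n) : open U -> U a ->
  exists (b : 'rV[R]_n -> R) (K V : set 'rV[R]_n),
    [/\ smooth_on setT b, forall x, 0 <= b x <= 1,
        [/\ open V, V a & forall x, V x -> b x = 1] &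
        [/\ compact K, K `<=` U & forall x, ~ K x -> b x = 0]].
Proof.
move=> oU Ua; have : nbhs a U by exact: open_nbhs_nbhs.
move=> /nbhs_closedballP[p]; have : 0 < p%:num by [].
move: p%:num => r r0 rU.
have r2 : 0 < r ^+ 2 by rewrite exprn_gt0.
(* The norm of rows is the maximum norm, which is not smooth, so the bump depends on the squared
   Euclidean distance while its support is controlled by a cube. The factor [2 / r ^+ 2] gives
   [d x >= 2], where [cutoff] vanishes, as soon as one coordinate is off by [r]. *)
pose d (x : 'rV[R]_n) : R := 2 / r ^+ 2 * \sum_i (x 0 i - a 0 i) ^+ 2.
have oT : open [set: 'rV[R]_n] by exact: openT.
have sd : smooth_on setT d.
  by apply: smooth_onM => //; [exact: smooth_on_cst|exact: smooth_on_sqdist].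
exists (cutoff \o d), [set x | forall i, `[a 0 i - r, a 0 i + r]%classic (x 0 i)],
  (d @^-1` [set t | t < 1]); split.
- by apply: smooth_on_comp1 => //; exact: smooth_on_cutoff.
- by move=> x; exact: cutoff_itv.
- split; last by move=> x /= /ltW; exact: cutoff1.
    apply: (@open_comp _ _ d [set t | t < 1]); last exact: open_lt.
    by move=> x _; apply: (smooth_on_continuous sd); exact: I.
  by rewrite /= /d big1 ?mulr0// => i _; rewrite subrr expr0n.
- split.
  + apply: (@rV_compact _ _ (fun i => `[a 0 i - r, a 0 i + r]%classic)) => i.
    exact: segment_compact.
  + move=> x /= Kx; apply: rU; rewrite closed_ballE// /closed_ball_/=.
    rewrite [leLHS]/Num.Def.normr/= mx_normrE; apply: bigmax_le => [|[i j] _]/=.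
      exact: ltW.
    rewrite !mxE ord1; have := Kx j; rewrite /= in_itv/= => /andP[x1 x2].
    by rewrite ler_norml; lra.
  + move=> x /= /existsNP[i] xi; apply: cutoff0.
    rewrite /d (bigD1 i)//= mulrDr.
    have le2 : 2 <= 2 / r ^+ 2 * (x 0 i - a 0 i) ^+ 2.
      rewrite mulrAC ler_pdivlMr// ler_pM2l//.
      rewrite -(real_normK (num_real (x 0 i - a 0 i))) lerXn2r ?nnegrE//; last 2 first.
      - exact: ltW.
      - rewrite leNgt; apply/negP => xr; apply: xi; rewrite in_itv/=.
        by move: xr; rewrite ltr_norml => /andP[? ?]; apply/andP; split; lra.
    apply: (le_trans le2); rewrite lerDl mulr_ge0//; first by rewrite divr_ge0 ?ltW.
    by apply: sumr_ge0 => j _; exact: sqr_ge0.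
Qed.

End bump.

(** * Charts and smooth functions on manifolds *)

Lemma open_setI_preimage (S T : topologicalType) (D : set S) (f : S -> T)
    (U : set T) : open D -> (forall y, D y -> {for y, continuous f}) -> open U ->
  open (D `&` f @^-1` U).
Proof.
move=> oD cf oU; rewrite openE => y [Dy Ufy]; rewrite /interior.
apply: filterI; first exact: open_nbhs_nbhs.
by apply: (cf y Dy); exact: open_nbhs_nbhs.
Qed.

Section charts.
Context {R : realType} {n : nat} {M : topologicalType}.
Implicit Types (c : chart R n M) (p : M) (x : 'rV[R]_n).

Lemma cmapKp c p : cdom c p -> cinv c (cmap c p) = p.
Proof. by move=> cp; rewrite cmapK// inE. Qed.

Lemma ctarget_cmap c p : cdom c p -> ctarget c (cmap c p).
Proof. by move=> cp; exists p. Qed.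

Lemma cdom_cinv c x : ctarget c x -> cdom c (cinv c x).
Proof. by move=> [p cp <-]; rewrite cmapKp. Qed.

Lemma cinvK c x : ctarget c x -> cmap c (cinv c x) = x.
Proof. by move=> [p cp <-]; rewrite cmapKp. Qed.

Lemma open_ctarget c : open (ctarget c).
Proof. exact: ctarget_open. Qed.

Lemma open_chart_preimage c (U : set M) :
  open U -> open (ctarget c `&` cinv c @^-1` U).
Proof.
by apply: open_setI_preimage; [exact: open_ctarget|exact: cinv_continuous].
Qed.

Lemma open_chart_image c (V : set 'rV[R]_n) :
  open V -> open (cdom c `&` cmap c @^-1` V).
Proof.
by apply: open_setI_preimage; [exact: cdom_open|exact: cmap_continuous].
Qed.

Lemma overlapE c (U : set M) :
  cmap c @` (cdom c `&` U) = ctarget c `&` cinv c @^-1` U.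
Proof.
apply/seteqP; split=> [_ [p [cp Up] <-]|x [cx Ux]].
  by split; [exact: ctarget_cmap|rewrite /= cmapKp].
by exists (cinv c x); [split=> //; exact: cdom_cinv|exact: cinvK].
Qed.

Lemma open_overlap c (U : set M) : open U -> open (cmap c @` (cdom c `&` U)).
Proof. by rewrite overlapE; exact: open_chart_preimage. Qed.

Lemma transition_cmap c c' p : cdom c p -> transition c c' (cmap c p) = cmap c' p.
Proof. by move=> cp; rewrite /transition/= cmapKp. Qed.

Lemma near_chart c p (U : set M) : cdom c p -> open U -> U p ->
  \forall y \near cmap c p, ctarget c y /\ U (cinv c y).
Proof.
move=> cp oU Up.
have m : (ctarget c `&` cinv c @^-1` U) (cmap c p).
  by split; [exact: ctarget_cmap|rewrite /= cmapKp].
exact: (open_near (open_chart_preimage oU) m (fun y h => h)).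
Qed.

End charts.
Arguments open_ctarget {R n M} c.
Arguments open_chart_preimage {R n M} c [U].

Section manifolds.
Context {R : realType} {n : nat} {M : smooth_manifold R n}.
Implicit Types (c : chart R n M) (p : M) (x : 'rV[R]_n).

Lemma smooth_transition c c' : atlas M c -> atlas M c' ->
  smooth_on (cmap c @` (cdom c `&` cdom c')) (transition c c').
Proof. exact: atlas_compatible. Qed.

Lemma differentiable_transition c c' p : atlas M c -> atlas M c' ->
  cdom c p -> cdom c' p -> differentiable (transition c c') (cmap c p).
Proof.
move=> ac ac' cp c'p; apply: smooth_on_differentiable (smooth_transition ac ac') _.
by exists p.
Qed.

Lemma jacobian_transitionK c c' p : atlas M c -> atlas M c' ->
  cdom c p -> cdom c' p ->
  jacobian (transition c c') (cmap c p) *m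
  jacobian (transition c' c) (cmap c' p) = 1%:M.
Proof.
move=> ac ac' cp c'p; apply/row_matrixP => i; rewrite !rowE mulmxA mulmx1.
have d1 := differentiable_transition ac ac' cp c'p.
have d2 := differentiable_transition ac' ac c'p cp.
rewrite -(deriveEjacobian _ d1) -(deriveEjacobian _ d2).
rewrite -[X in 'D__ _ X](transition_cmap c' cp) -derive_comp//; last first.
  by rewrite transition_cmap.
rewrite -[RHS](derive_id (cmap c p)); apply: near_eq_derive.
have := near_chart cp (cdom_open c') c'p; apply: filterS => y [cy c'y].
by rewrite /transition/= cmapKp// cinvK.
Qed.

Lemma smooth_function_local (f : M -> R) :
  (forall p, exists2 c, atlas M c /\ cdom c p &
     exists2 V, open V /\ V (cmap c p) & smooth_on V (f \o cinv c)) ->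
  smooth_function f.
Proof.
move=> fl c ac; apply: smooth_on_local => x cx.
have [c' [ac' c'p] [V [oV Vp] SV]] := fl (cinv c x).
have cp := cdom_cinv cx.
pose U := cmap c @` (cdom c `&` (cdom c' `&` cmap c' @^-1` V)).
have oU : open U by apply: open_overlap; exact: open_chart_image.
exists U; first by exists (cinv c x) => //; exact: cinvK.
apply: (@smooth_on_eq _ _ _ _ ((f \o cinv c') \o transition c c')) => //.
  by move=> _ [q [cq [c'q _]] <-]; rewrite /transition/= !cmapKp.
apply: (smooth_on_comp oU _ _ SV).
  by move=> _ [q [cq [c'q Vq]] <-]; rewrite transition_cmap.
apply: smooth_on_mono (smooth_transition ac ac').
by move=> _ [q [cq [c'q Vq]] <-]; exists q.
Qed.

Lemma smooth_functionM (f g : M -> R) :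
  smooth_function f -> smooth_function g -> smooth_function (fun p => f p * g p).
Proof. by move=> sf sg c ac; apply: smooth_onM (sf c ac) (sg c ac); exact: open_ctarget. Qed.

Lemma smooth_functionB (f g : M -> R) :
  smooth_function f -> smooth_function g -> smooth_function (fun p => f p - g p).
Proof. by move=> sf sg c ac; apply: smooth_onB (sf c ac) (sg c ac); exact: open_ctarget. Qed.

Lemma smooth_function_cst (a : R) : smooth_function (fun _ : M => a).
Proof. by move=> c _; exact: smooth_on_cst. Qed.

Lemma smooth_function_prod k (f : 'I_k -> M -> R) :
  (forall i, smooth_function (f i)) ->
  smooth_function (fun p => \prod_(i < k) f i p).
Proof.
move=> sf c ac; rewrite /comp; apply: smooth_on_prod => [|i _].
  exact: open_ctarget.
exact: sf.
Qed.

(** The factor [theta] hides the junk values of [cmap c]: [cdom c] and the complement of [K] cover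
    [M], and on the latter the product is zero. *)
Lemma smooth_function_extend0 c (f : 'rV[R]_n -> R) (theta : M -> R) (K : set M) :
  atlas M c -> closed K -> K `<=` cdom c -> smooth_function theta ->
  (forall p, ~ K p -> theta p = 0) -> smooth_on (ctarget c) f ->
  smooth_function (fun p => theta p * f (cmap c p)).
Proof.
move=> ac clK Kc sth th0 sf; apply: smooth_function_local => p.
have [cp|ncp] := pselect (cdom c p).
  exists c => //; exists (ctarget c); first by split; [exact: open_ctarget|exact: ctarget_cmap].
  apply: (@smooth_on_eq _ _ _ _ (fun x => (theta \o cinv c) x * f x)).
  - exact: open_ctarget.
  - by move=> x cx; rewrite /= cinvK.
  - by apply: smooth_onM => //; [exact: open_ctarget|exact: sth].
have [c' ac' c'p] := atlas_cover p; exists c' => //.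
have oK : open (~` K) by exact: closed_openC.
exists (ctarget c' `&` cinv c' @^-1` (~` K)).
  split; first exact: open_chart_preimage.
  by split; [exact: ctarget_cmap|rewrite /= cmapKp// => /Kc].
apply: (@smooth_on_eq _ _ _ _ (fun=> 0)) => //; last exact: smooth_on_cst.
  exact: open_chart_preimage.
by move=> x [_ /= nK]; rewrite th0// mul0r.
Qed.

Lemma manifold_bump p (U : set M) : open U -> U p ->
  exists (b : M -> R) (K V : set M),
    [/\ smooth_function b, forall q, 0 <= b q <= 1,
        [/\ open V, V p & forall q, V q -> b q = 1] &
        [/\ closed K, K `<=` U & forall q, ~ K q -> b q = 0]].
Proof.
move=> oU Up; have [c ac cp] := atlas_cover p.
have [b [K [V [sb b01 [oV Vp b1] [cK KU b0]]]]] :=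
  rV_bump (open_chart_preimage c oU)
    (conj (ctarget_cmap cp) (eq_ind_r U Up (cmapKp cp))).
(* The support must be closed in [M] and not merely in the chart domain, for the extension by zero
   to be smooth. Compactness in a Hausdorff space provides this. *)
have clK : closed (cinv c @` K).
  apply: compact_closed; first exact: manifold_hausdorff.
  apply: continuous_compact => //; apply: continuous_in_subspaceT => x /set_mem /KU[cx _].
  exact: cinv_continuous.
have Kc : cinv c @` K `<=` cdom c by move=> _ [x /KU[cx _] <-]; exact: cdom_cinv.
pose B q := if pselect (cdom c q) then b (cmap c q) else 0.
have B0 q : ~ (cinv c @` K) q -> B q = 0.
  rewrite /B => nKq; case: pselect => // cq; apply: b0 => Kq; apply: nKq.
  by exists (cmap c q) => //; exact: cmapKp.
exists B, (cinv c @` K), (cdom c `&` cmap c @^-1` V); split.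
- apply: smooth_function_local => q; have [cq|ncq] := pselect (cdom c q).
    exists c => //; exists (ctarget c).
      by split; [exact: open_ctarget|exact: ctarget_cmap].
    apply: (@smooth_on_eq _ _ _ _ b); first exact: open_ctarget.
      move=> x cx; rewrite /B/=; case: pselect => [?|]; first by rewrite /= cinvK.
      by have := cdom_cinv cx.
    exact: smooth_on_mono sb.
  have [c' ac' c'q] := atlas_cover q; exists c' => //.
  have oK : open (~` (cinv c @` K)) by exact: closed_openC.
  exists (ctarget c' `&` cinv c' @^-1` (~` (cinv c @` K))).
    split; first exact: open_chart_preimage.
    split; [exact: ctarget_cmap|rewrite /= cmapKp// => /Kc; exact: ncq].
  apply: (@smooth_on_eq _ _ _ _ (fun=> 0)); last exact: smooth_on_cst.
    exact: open_chart_preimage.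
  by move=> x [_ /= nK]; rewrite B0.
- by move=> q; rewrite /B; case: pselect => [?|?] /=; [exact: b01|rewrite lexx ler01].
- split; [exact: open_chart_image|by []|].
  by move=> q [cq Vq]; rewrite /B; case: pselect => // ?; exact: b1.
- split=> //; move=> q [x Kx <-]; by have [_ Ux] := KU _ Kx.
Qed.

End manifolds.

(** Each member of a countable base, numbered by [f], picks one [V i] that contains it, if there is
    one; the picked sets still cover. [None] stands for the numbers that pick nothing. *)
Lemma lindelof (T : topologicalType) (I : Type) (V : I -> set T) :
  @second_countable T -> (forall i, open (V i)) -> (forall p, exists i, V i p) ->
  exists s : nat -> option I, forall p, exists k i, s k = Some i /\ V i p.
Proof.
move=> [B /countable_injP[f injf] [_ bB]] oV cov.
pose P k i := exists b, [/\ B b, f b = k & b `<=` V i].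
pose s k := if pselect (exists i, P k i) is left e then Some (projT1 (cid e))
            else None.
exists s => p; have [i0 Vi0p] := cov p.
have [b [Bb bp] bV] : filter_from [set U | B U /\ U p] id (V i0).
  by apply: bB; exact: open_nbhs_nbhs.
have e : exists i, P (f b) i by exists i0, b.
exists (f b), (projT1 (cid e)); split.
  by rewrite /s; case: pselect => // e'; rewrite (Prop_irrelevance e' e).
case: (cid e) => i [b' [Bb' fb' b'V]] /=; apply: b'V.
by rewrite (injf b' b) ?inE.
Qed.

(** * Functions that increase along a non-zero vector field *)

Section unit_form.
Context {R : realType} {n : nat} {M : smooth_manifold R n}.
Implicit Types (c : chart R n M) (p q : M) (x v : 'rV[R]_n).

Lemma derive_chart_change (f : M -> R) c c' p v : atlas M c -> atlas M c' ->
  cdom c p -> cdom c' p -> smooth_function f ->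
  'D_v (f \o cinv c) (cmap c p) =
  'D_(v *m jacobian (transition c c') (cmap c p)) (f \o cinv c') (cmap c' p).
Proof.
move=> ac ac' cp c'p sf.
have dt := differentiable_transition ac ac' cp c'p.
have df : differentiable (f \o cinv c') (cmap c' p).
  by apply: smooth_on_differentiable (sf _ ac') _; exact: ctarget_cmap.
rewrite -(deriveEjacobian _ dt) -[X in 'D__ _ X = _](cinvK (ctarget_cmap cp)).
rewrite cinvK; last exact: ctarget_cmap.
rewrite -[X in _ = 'D__ _ X](transition_cmap c' cp) -derive_comp ?transition_cmap//.
apply: near_eq_derive.
have := near_chart cp (cdom_open c') c'p; apply: filterS => y [cy c'y].
by rewrite /transition/= cmapKp.
Qed.

(** A relation and not a function, because a point has no preferred chart; the value agrees in all
    charts around it. *)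
Definition directional (X : vector_field M) (f : M -> R) p r : Prop :=
  forall c, atlas M c -> cdom c p -> 'D_(X c (cmap c p)) (f \o cinv c) (cmap c p) = r.

Lemma directional_exists X (f : M -> R) c p : atlas M c -> cdom c p ->
  smooth_function f ->
  directional X f p ('D_(X c (cmap c p)) (f \o cinv c) (cmap c p)).
Proof.
move=> ac cp sf c' ac' c'p.
by rewrite (@derive_chart_change f c c')// -vf_transition.
Qed.

(** In a chart where the [i]-th component of [X] is non-zero at [p], the [i]-th coordinate times the
    sign of that component increases along [X] near [p]. One bump extends this function to [M], and
    a second bump [rho] is supported where the extension still increases. *)
Lemma local_increasing_function (X : vector_field M) p :
  (forall c, atlas M c -> cdom c p -> X c (cmap c p) != 0) ->
  exists (rho g : M -> R) (V : set M),
    [/\ smooth_function rho, smooth_function g, forall q, 0 <= rho q <= 1,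
        [/\ open V, V p & forall q, V q -> rho q = 1] &
        forall q, rho q != 0 -> exists2 r, 0 < r & directional X g q r].
Proof.
move=> X0; have [c ac cp] := atlas_cover p.
have /rV0Pn[i Xi] := X0 c ac cp.
pose e : R := Num.sg (X c (cmap c p) 0 i).
pose l x : R := e * x 0 i.
have sl U : open U -> smooth_on U l.
  move=> oU; apply: smooth_onM => //; first exact: smooth_on_cst.
  by apply: smooth_on_coord => //; exact: smooth_on_id.
have [th [K [W [sth th01 [oW Wp th1] [clK Kc th0]]]]] := manifold_bump (cdom_open c) cp.
pose g q := th q * l (cmap c q).
have sg : smooth_function g.
  by apply: smooth_function_extend0 ac clK Kc sth th0 _; apply: sl; exact: open_ctarget.
have cX : smooth_on (ctarget c) (fun x => l (X c x)).
  have oc := open_ctarget c.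
  apply: smooth_onM => //; first exact: smooth_on_cst.
  by apply: smooth_on_coord => //; exact: vf_smooth.
(* On [W] the bump [th] is 1, so [g] coincides there with the linear function [l], whose derivative
   along [X] is [l] of [X]. *)
pose U := W `&` (cdom c `&` cmap c @^-1`
  (ctarget c `&` (fun x => l (X c x)) @^-1` [set t | 0 < t])).
have oU : open U.
  apply: openI => //; apply: open_chart_image; apply: open_setI_preimage.
  - exact: open_ctarget.
  - by move=> x cx; exact: smooth_on_continuous cX cx.
  - exact: open_gt.
have Up : U p.
  split=> //; split=> //; split; first exact: ctarget_cmap.
  by rewrite /= /l /e -normrEsg normr_gt0.
have [rho [K' [V [srho rho01 [oV Vp rho1] [clK' K'U rho0]]]]] := manifold_bump oU Up.
exists rho, g, V; split=> // q rhoq.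
have [Wq [cq [_ lq]]] : U q.
  by apply: K'U; apply: contrapT => /rho0 E; move: rhoq; rewrite E eqxx.
exists (l (X c (cmap c q))) => //.
rewrite (_ : l _ = 'D_(X c (cmap c q)) (g \o cinv c) (cmap c q)).
  exact: directional_exists.
have -> : 'D_(X c (cmap c q)) (g \o cinv c) (cmap c q) =
    'D_(X c (cmap c q)) l (cmap c q).
  apply: near_eq_derive; have := near_chart cq oW Wq.
  by apply: filterS => y [cy Wy]; rewrite /g/= th1// mul1r cinvK.
rewrite [RHS]deriveMl; last first.
  apply: diff_derivable; exact: differentiable_coord.
by rewrite -(derive_coord (f := id))// derive_id.
Qed.

End unit_form.

(** * Gluing a 1-form *)

Section gluing.
Context {R : realType} {n : nat} {M : smooth_manifold R n}.
Context {X : vector_field M} {rho g : nat -> M -> R}.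
Hypothesis srho : forall k, smooth_function (rho k).
Hypothesis sg : forall k, smooth_function (g k).
Hypothesis rho01 : forall k q, 0 <= rho k q <= 1.
Hypothesis Xg_gt0 : forall k q, rho k q != 0 ->
  exists2 r, 0 < r & directional X (g k) q r.
Hypothesis rho1 : forall q, exists k (V : set M),
  [/\ open V, V q & forall q', V q' -> rho k q' = 1].
Implicit Types (c : chart R n M) (x : 'rV[R]_n) (v : 'M[R]_(1, n)).

(* [sigma k] vanishes wherever an earlier [rho j] is 1, so that the family is
   locally finite without any hypothesis on the supports of the [rho k]. *)
Let sigma k q := rho k q * \prod_(j < k) (1 - rho j q).

Let partial_form N c x v :=
  \sum_(k < N) sigma k (cinv c x) * 'D_v (g k \o cinv c) x.

Let index q : nat := projT1 (cid (rho1 q)).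

(** The infinite sum of the [sigma k] times [d(g k)]: at a point [q] the terms after [index q]
    vanish. The place of truncation may jump from point to point, which [form_partial] repairs. *)
Let form : form_rep M 1 := fun c x v => partial_form (index (cinv c x)).+1 c x v.

Let rho_index q : rho (index q) q = 1.
Proof. by rewrite /index; case: (cid _) => k /= [V [_ Vq]]; apply. Qed.

Let index_nbhs q : exists2 V : set M, open V /\ V q &
  forall q', V q' -> rho (index q) q' = 1.
Proof. by rewrite /index; case: (cid _) => k /= [V [oV Vq V1]]; exists V. Qed.

Let smooth_sigma k : smooth_function (sigma k).
Proof.
apply: smooth_functionM => //; apply: smooth_function_prod => i.
by apply: smooth_functionB => //; exact: smooth_function_cst.
Qed.

Let sigma_ge0 k q : 0 <= sigma k q.
Proof.
have /andP[r0 _] := rho01 k q; apply: mulr_ge0 => //; apply: prodr_ge0 => j _.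
by have /andP[_ r1] := rho01 j q; rewrite subr_ge0.
Qed.

Let sigma0 k j q : (j < k)%N -> rho j q = 1 -> sigma k q = 0.
Proof.
move=> jk r1; rewrite /sigma (bigD1 (Ordinal jk))//= r1 subrr mul0r.
by rewrite mulr0.
Qed.

Let partial_form_stable N j c x v : (j < N)%N -> rho j (cinv c x) = 1 ->
  partial_form N c x v = partial_form j.+1 c x v.
Proof.
move=> jN r1; rewrite /partial_form.
rewrite -!(big_mkord xpredT (fun k => sigma k (cinv c x) * 'D_v (g k \o cinv c) x)).
rewrite (@big_cat_nat _ _ _ j.+1)//=.
have -> : \sum_(j.+1 <= k < N) sigma k (cinv c x) * 'D_v (g k \o cinv c) x = 0.
  rewrite big_nat_cond big1// => k /andP[/andP[jk _] _].
  by rewrite (sigma0 jk r1) mul0r.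
by rewrite addr0.
Qed.

(** Both truncations agree with a longer one that reaches both indices. Hence [form] is a fixed
    finite sum near [q0], which is what smoothness needs. *)
Let form_partial q0 V c x v : (forall q', V q' -> rho (index q0) q' = 1) ->
  V (cinv c x) -> form c x v = partial_form (index q0).+1 c x v.
Proof.
move=> V1 Vx; rewrite /form.
pose N := (maxn (index (cinv c x)) (index q0)).+1.
rewrite -(@partial_form_stable N (index (cinv c x)))//; last first.
  by rewrite ltnS leq_maxl.
by rewrite (@partial_form_stable N (index q0))// ?ltnS ?leq_maxr//; exact: V1.
Qed.

Let dg c x k : atlas M c -> ctarget c x -> differentiable (g k \o cinv c) x.
Proof. by move=> ac cx; apply: smooth_on_differentiable (sg k ac) cx. Qed.

Let form_linear c x : atlas M c -> ctarget c x -> forall a u v,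
  form c x (a *: u + v) = a * form c x u + form c x v.
Proof.
move=> ac cx a u v; rewrite /form /partial_form mulr_sumr -big_split/=.
apply: eq_bigr => k _; have d := dg k ac cx.
by rewrite !(deriveE _ d) linearP/= mulrDr -mulr_algl mulr_algl mulrCA.
Qed.

Let form_gt0 c x : atlas M c -> ctarget c x -> 0 < form c x (X c x).
Proof.
move=> ac cx; rewrite /form /partial_form.
set q := cinv c x; set N := (index q).+1.
have cq : cdom c q := cdom_cinv cx.
have ge0 k : 0 <= sigma k q * 'D_(X c x) (g k \o cinv c) x.
  have [r0|/Xg_gt0[r r0 Xr]] := eqVneq (rho k q) 0.
    by rewrite /sigma r0 !mul0r.
  have := Xr c ac cq; rewrite cinvK// => ->.
  by rewrite mulr_ge0// ltW.
have ex : exists k, rho k q != 0 by exists (index q); rewrite rho_index oner_eq0.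
(* For the least [k] with [rho k q != 0] all factors [1 - rho j q] equal 1, so [sigma k q = rho k q]
   is positive; the other terms are only nonnegative. *)
pose k := ex_minn ex.
have [kr kmin] : rho k q != 0 /\ forall j, rho j q != 0 -> (k <= j)%N.
  by rewrite /k; case: ex_minnP.
have kN : (k < N)%N by rewrite ltnS kmin// rho_index oner_eq0.
rewrite (bigD1 (Ordinal kN))//=; apply: ltr_pwDl; last by apply: sumr_ge0.
have [r r0 Xr] := Xg_gt0 kr.
have := Xr c ac cq; rewrite cinvK// => ->; rewrite mulr_gt0//.
rewrite /sigma big1 ?mulr1.
  by rewrite lt_def kr; have /andP[] := rho01 k q.
move=> j _; have [->|/kmin] := eqVneq (rho j q) 0; first by rewrite subr0.
by rewrite leqNgt ltn_ord.
Qed.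

Let form_transition c c' p v : atlas M c -> atlas M c' ->
  cdom c p -> cdom c' p ->
  form c (cmap c p) v =
  form c' (cmap c' p) (v *m jacobian (transition c c') (cmap c p)).
Proof.
move=> ac ac' cp c'p; rewrite /form/partial_form !cmapKp//.
by apply: eq_bigr => k _; rewrite (@derive_chart_change _ _ _ _ c c').
Qed.

(** The argument may vary with the point, so that the lemma covers constant vectors as well as [X]
    itself, the denominator of the normalised form. *)
Let smooth_form c (w : 'rV[R]_n -> 'rV[R]_n) : atlas M c ->
  smooth_on (ctarget c) w -> smooth_on (ctarget c) (fun x => form c x (w x)).
Proof.
move=> ac sw; apply: smooth_on_local => x cx.
have [V [oV Vx] V1] := index_nbhs (cinv c x).
have oU := open_chart_preimage c oV.
exists (ctarget c `&` cinv c @^-1` V); first by [].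
have sU : ctarget c `&` cinv c @^-1` V `<=` ctarget c by move=> y [].
apply: (@smooth_on_eq _ _ _ _ (fun y => \sum_(k < (index (cinv c x)).+1)
  sigma k (cinv c y) * \sum_j w y 0 j * 'D_(delta_mx 0 j) (g k \o cinv c) y)) => //.
  move=> y [cy Vy]; rewrite (form_partial _ V1 Vy); apply: eq_bigr => k _.
  by congr (_ * _); rewrite [RHS]derive_sum_delta//; exact: dg.
apply: smooth_on_sum => // k _; apply: smooth_onM => //.
  exact: smooth_on_mono (smooth_sigma k ac).
apply: smooth_on_sum => // j _; apply: smooth_onM => //.
  by apply: smooth_on_coord => //; exact: smooth_on_mono sw.
by apply: smooth_on_derive; exact: smooth_on_mono (sg k ac).
Qed.

(** [form] is positive on [X], so it can be divided by its value there. The quotient is a form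
    because that value does not depend on the chart. *)
Lemma unit_form_glue : exists alpha : diff_form M 1,
  forall c, atlas M c -> forall x, ctarget c x -> df alpha c x (X c x) = 1.
Proof.
pose a : form_rep M 1 := fun c x v => form c x v / form c x (X c x).
have aM c : atlas M c -> forall x, ctarget c x -> Defs.multilinear (a c x).
  move=> ac x cx A B C i b d; rewrite !row_id => -> _ _.
  rewrite /a form_linear// -[d *: C]addr0 form_linear//.
  have -> : form c x 0 = 0.
    by have := form_linear ac cx (-1) 0 0; rewrite scaler0 addr0 mulN1r addNr.
  by rewrite addr0 mulrDl !mulrA.
have aA c : atlas M c -> forall x, ctarget c x -> Defs.alternating (a c x).
  by move=> _ x _ A i j; rewrite !ord1 eqxx.
have aT c c' : atlas M c -> atlas M c' -> forall p, cdom c p -> cdom c' p ->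
    forall v : 'M[R]_(1, n), a c (cmap c p) v =
    a c' (cmap c' p) (v *m jacobian (transition c c') (cmap c p)).
  move=> ac ac' p cp c'p v; rewrite /a (form_transition _ ac ac')//.
  by rewrite (form_transition (X c _) ac ac')// -vf_transition.
have aS c : atlas M c -> forall v : 'M[R]_(1, n),
    smooth_on (ctarget c) (fun x => a c x v).
  move=> ac v; have oc := open_ctarget c; apply: smooth_onM => //.
    by apply: smooth_form => //; exact: smooth_on_cst.
  apply: smooth_onV => //; last by apply: smooth_form => //; exact: vf_smooth.
  by move=> x cx; rewrite gt_eqF// form_gt0.
exists (DiffForm aM aA aT aS) => c ac x cx /=.
by rewrite /a divff// gt_eqF// form_gt0.
Qed.

End gluing.

Lemma unit_form_exists (R : realType) n (M : smooth_manifold R n)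
    (X : vector_field M) :
  (forall c, atlas M c -> forall p, cdom c p -> X c (cmap c p) != 0) ->
  exists alpha : diff_form M 1,
  forall c, atlas M c -> forall x, ctarget c x -> df alpha c x (X c x) = 1.
Proof.
move=> X0.
have [f fP] := choice (fun p => local_increasing_function (fun c ac => X0 c ac p)).
have [h hP] := choice fP.
have [V VP] := choice hP.
have [s sP] := @lindelof M M V (@manifold_second_countable _ _ M)
  (fun p => let: And5 _ _ _ (And3 oV _ _) _ := VP p in oV)
  (fun p => ex_intro _ p (let: And5 _ _ _ (And3 _ Vp _) _ := VP p in Vp)).
(* Numbers without a point receive zero functions, which contribute nothing to the sum and satisfy
   the positivity condition vacuously. *)
pose rho k := if s k is Some p then f p else fun=> 0.
pose g k := if s k is Some p then h p else fun=> 0.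
apply: (@unit_form_glue _ _ _ X rho g).
- move=> k; rewrite /rho; case: (s k) => [p|]; last exact: smooth_function_cst.
  by have [] := VP p.
- move=> k; rewrite /g; case: (s k) => [p|]; last exact: smooth_function_cst.
  by have [] := VP p.
- move=> k q; rewrite /rho; case: (s k) => [p|]; last by rewrite lexx ler01.
  by have [] := VP p.
- move=> k q; rewrite /rho /g; case: (s k) => [p|]; last by rewrite eqxx.
  by have [_ _ _ _] := VP p; apply.
- move=> q; have [k [p [skp Vpq]]] := sP q; exists k, (V p); rewrite /rho skp.
  by have [_ _ _ [oV _ V1] _] := VP p; split.
Qed.

(** * Zeros of a vector field and its orbits *)

Section zero_orbit.
Context {R : realType}.

Lemma derive_bound (f df : R -> R) (a b C : R) :
  (forall t, a <= t <= b -> is_derive t (1 : R) f (df t)) ->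
  (forall t, a <= t <= b -> `|df t| <= C) ->
  forall s t, a <= s <= b -> a <= t <= b -> `|f t - f s| <= C * `|t - s|.
Proof.
move=> fd dC; suff H s t : a <= s -> t <= b -> s < t ->
    `|f t - f s| <= C * `|t - s|.
  move=> s t /andP[sa sb] /andP[ta tb]; have [st|ts|->] := ltgtP s t.
  - exact: H.
  - by rewrite distrC (distrC t); exact: H.
  - by rewrite !subrr normr0 mulr0.
move=> sa tb st.
have I u : s <= u <= t -> a <= u <= b.
  by move=> /andP[su ut]; rewrite (le_trans sa su) (le_trans ut tb).
have [] := @MVT R f df s t st.
- by move=> u; rewrite in_itv/= => /andP[su ut]; apply/fd/I; rewrite !ltW.
- apply: derivable_within_continuous => u; rewrite in_itv/= => /I/fd d.
  exact: ex_derive.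
- move=> u; rewrite in_itv/= => /andP[su ut] ->; rewrite normrM ler_wpM2r//.
  by apply/dC/I; rewrite !ltW.
Qed.

(** In the constant [k + 1], [k] bounds the differential and 1 bounds the remainder near [x]. *)
Lemma zero_lipschitz (V W : normedModType R) (f : V -> W) (x : V) :
  differentiable f x -> f x = 0 ->
  exists2 L, 0 < L & \forall y \near x, `|f y| <= L * `|y - x|.
Proof.
move=> df fx0.
have [k k0 kP] := linear_lipschitz (diff_continuous df).
exists (k + 1); first by rewrite ltr_wpDl// ltW.
have := diff_locally df; rewrite fx0 => /eqaddoP/(_ 1 ltr01) e.
have : \forall h \near 0, `|(f \o shift x) h| <= (k + 1) * `|h|.
  apply: filterS e => h; rewrite !fctE/= => e.
  rewrite -[f _](subrK ('d f x h)) (le_trans (ler_normD _ _))//.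
  rewrite addrC mulrDl lerD//; apply: le_trans e.
  by rewrite add0r.
by rewrite (near_shift x) sub0r; apply: filterS => y /=; rewrite subrK.
Qed.

Context {n : nat} {M : smooth_manifold R n} {X : vector_field M}.

(** Uniqueness of the constant solution: near a zero the speed is at most [L] times the distance to
    it, so on a short time interval the largest distance is at most half of itself. *)
Lemma zero_near c p (g : R -> M) (I : set R) (t0 : R) : atlas M c -> cdom c p ->
  X c (cmap c p) = 0 -> open I -> integral_curve X I g -> I t0 -> g t0 = p ->
  \forall t \near t0, g t = p.
Proof.
move=> ac cp X0 oI gI It0 gt0.
pose x0 := cmap c p.
have dX : differentiable (X c) x0.
  by apply: smooth_on_differentiable (vf_smooth X ac) _; exact: ctarget_cmap.
have [L L0 LP] := zero_lipschitz dX X0.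
pose gam := cmap c \o g.
have cg0 : {for t0, continuous g} by have [] := gI _ It0.
have cgam : {for t0, continuous gam}.
  by apply: continuous_comp => //; rewrite gt0; exact: cmap_continuous.
have n1 : \forall t \near t0, I t by exact: open_nbhs_nbhs.
have n2 : \forall t \near t0, cdom c (g t).
  by apply: cg0; rewrite gt0; apply: open_nbhs_nbhs; split=> //; exact: cdom_open.
have n3 : \forall t \near t0, `|X c (gam t)| <= L * `|gam t - x0|.
  by apply: (cgam [set y | `|X c y| <= L * `|y - x0|]); rewrite /gam/= gt0.
have : \forall t \near t0, [/\ I t, cdom c (g t) & `|X c (gam t)| <= L * `|gam t - x0|].
  by near=> t; split; near: t.
move=> /nbhs_ballP[r /= r0 rP].
(* [r / 2] keeps the closed interval of radius [d] inside the ball of radius [r]; [1 / 2 / L] yields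
   the contraction factor [L * d <= 1 / 2]. *)
pose d := Num.min (r / 2) (1 / 2 / L).
have d0 : 0 < d by rewrite lt_min !divr_gt0.
have dL : L * d <= 1 / 2.
  by rewrite mulrC -ler_pdivlMr// ge_min lexx orbT.
have dr t : t0 - d <= t <= t0 + d -> ball t0 r t.
  move=> /andP[t1 t2]; have : d <= r / 2 by rewrite ge_min lexx.
  by rewrite -ball_normE/= ltr_norml => ?; apply/andP; split; lra.
have dgam t : t0 - d <= t <= t0 + d -> is_derive t (1 : R) gam (X c (gam t)).
  by move=> /dr/rP[It ct _]; have [_] := gI t It; apply.
have dgamj j t : t0 - d <= t <= t0 + d ->
    is_derive t (1 : R) (fun s => gam s 0 j) (X c (gam t) 0 j).
  move=> /dgam[dt <-]; apply: DeriveDef; first exact: ((derivable_mxP _ _ _).1 dt 0 j).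
  by rewrite (derive_mx dt) mxE.
have t0I : t0 - d <= t0 <= t0 + d by rewrite lerBlDr lerDl (ltW d0).
have [||t1 t1I t1max] := @EVT_max R (fun t => `|gam t - x0|) (t0 - d) (t0 + d).
- by case/andP: t0I; exact: le_trans.
- apply: continuous_in_subspaceT => t; rewrite inE/= in_itv/= => tI.
  have [dt _] := dgam t tI.
  have ct : {for t, continuous gam}.
    by apply: differentiable_continuous; apply/derivable1_diffP.
  by apply: cvg_norm; apply: cvgB => //; exact: cvg_cst.
have max t : t0 - d <= t <= t0 + d -> `|gam t - x0| <= `|gam t1 - x0|.
  by move=> tI; apply: t1max; rewrite in_itv.
move: t1I; rewrite in_itv/= => t1I.
set m := `|gam t1 - x0| in max.
(* The mean value theorem bounds the maximum m of |gam - x0| by L d m. *)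
have m0 : m <= 1 / 2 * m.
  (* The norm of a row is the maximum over its entries, so a bound for each coordinate suffices, and
     each coordinate is a real function of time. *)
  rewrite {1}/m [leLHS]/Num.Def.normr/= mx_normrE; apply: bigmax_le => [|[i j] _]/=.
    by apply: mulr_ge0; [rewrite divr_ge0|exact: normr_ge0].
  rewrite !mxE ord1.
  have gt0E : x0 0 j = gam t0 0 j by rewrite /gam/= gt0.
  rewrite gt0E.
  have := @derive_bound (fun t => gam t 0 j) (fun t => X c (gam t) 0 j)
    (t0 - d) (t0 + d) (L * m) (dgamj j) _ t0 t1 t0I t1I.
  move=> H; apply: le_trans (H _) _.
    move=> t tI; have [_ _ XL] := rP _ (dr t tI).
    apply: (@le_trans _ _ `|X c (gam t)|).
      rewrite [leRHS]/Num.Def.normr/= mx_normrE.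
      exact: (le_bigmax _ (fun i => `|X c (gam t) i.1 i.2|) (0, j)).
    by apply: (le_trans XL); rewrite ler_pM2l// max.
  apply: (@le_trans _ _ (L * m * d)); last first.
    by rewrite mulrAC; apply: ler_wpM2r; [exact: normr_ge0|exact: dL].
  apply: ler_wpM2l; first by apply: mulr_ge0; [exact: ltW|exact: normr_ge0].
  by rewrite ler_norml; lra.
have m00 : m = 0 by apply/le_anti/andP; split; [lra|exact: normr_ge0].
have : nbhs t0 (ball t0 d) by exact: nbhsx_ballx.
apply: filterS => t; rewrite -ball_normE/= ltr_norml => /andP[td1 td2].
have tI : t0 - d <= t <= t0 + d by apply/andP; split; lra.
have [_ ct _] := rP _ (dr t tI).
have : `|gam t - x0| <= 0 by rewrite -m00 max.
rewrite normr_le0 subr_eq0 => /eqP E.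
by rewrite -(cmapKp ct) -(cmapKp cp) -/x0 -E.
Unshelve. all: by end_near. Qed.

(** The times at which the curve is at [p] form a nonempty subset of the interval that is open by
    [zero_near] and relatively closed; the interval is connected. *)
Lemma zero_flow c p q t : atlas M c -> cdom c p -> X c (cmap c p) = 0 ->
  flow X t p q -> q = p.
Proof.
move=> ac cp X0 [a [b [g [ab atb gX g0 <-]]]].
pose S := `]a, b[%classic `&` g @^-1` [set p].
have oab : open (`]a, b[%classic : set R) by exact: itv_open.
suff : S = `]a, b[%classic.
  by move=> SE; have [] : S t by rewrite SE /= in_itv.
have conn : connected (`]a, b[%classic : set R).
  by apply/connected_intervalP; exact: interval_is_interval.
apply: conn.
- by exists 0; split=> //=; rewrite in_itv.
- exists S; last by rewrite setIA setIid.
  rewrite openE => s [Is gs]; rewrite /interior.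
  apply: filterI; first exact: open_nbhs_nbhs.
  exact: (zero_near ac cp X0 oab gX Is gs).
- exists (~` (`]a, b[%classic `&` g @^-1` (~` [set p]))).
    apply: open_closedC; apply: open_setI_preimage => //.
      by move=> s Is; have [] := gX s Is.
    apply: closed_openC; apply: accessible_closed_set1.
    by apply: hausdorff_accessible; exact: manifold_hausdorff.
  apply/seteqP; split=> s [Is]; first by move=> gs; split=> // -[_]; apply.
  by move=> nS; split=> //; apply: contrapT => gs; apply: nS.
Qed.

End zero_orbit.

Lemma cross_section_nonvanishing (R : realType) (M : smooth_manifold R 3)
    (X : vector_field M) (N : set M) : global_cross_section X N ->
  forall c, atlas M c -> forall p, cdom c p -> X c (cmap c p) != 0.
Proof.
move=> [subN _ orbN trN _] c ac p cp; apply/eqP => X0.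
have [q [[t pq] Nq]] := orbN p.
move: Nq; rewrite (zero_flow ac cp X0 pq) => Np.
apply: (trN p Np c ac cp); rewrite X0.
(* The zero vector satisfies every linear equation, but membership in [tangent_space] also asks for
   a slice chart around [p]. *)
have [s sN sp] := subN p Np.
by exists s; split=> // i _; rewrite mul0mx mxE.
Qed.

(** * Exterior derivative of 1-forms in coordinates *)

Section exterior_derivative.
Context {R : realType}.

(** The formula of [ext_derivative], to which it is convertible, freed from manifold and charts: it
    can then be compared between row spaces of different dimensions and used before the thickened
    manifold exists. *)
Definition extd k n (w : 'rV[R]_n -> 'M[R]_(k, n) -> R) (x : 'rV[R]_n)
    (v : 'M[R]_(k.+1, n)) : R :=
  \sum_(i < k.+1) (-1) ^+ i * 'D_(row i v) (fun y => w y (row' i v)) x.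

Lemma row'2_0 n (A : 'M[R]_(2, n)) : row' ord0 A = row ord_max A.
Proof.
by apply/matrixP => i j; rewrite !mxE; congr (A _ j); apply: val_inj; rewrite ord1.
Qed.

Lemma row'2_1 n (A : 'M[R]_(2, n)) : row' ord_max A = row ord0 A.
Proof.
by apply/matrixP => i j; rewrite !mxE; congr (A _ j); apply: val_inj; rewrite ord1.
Qed.

Lemma extd1E n (b : 'rV[R]_n -> 'M[R]_(1, n) -> R) x (A : 'M[R]_(2, n)) :
  extd b x A = 'D_(row ord0 A) (b ^~ (row ord_max A)) x -
               'D_(row ord_max A) (b ^~ (row ord0 A)) x.
Proof.
rewrite /extd big_ord_recr big_ord1/= expr0 mul1r expr1 mulN1r.
rewrite (_ : widen_ord _ _ = ord0); last exact: val_inj.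
by rewrite row'2_0 row'2_1.
Qed.

(** Forms take matrices as arguments. This relation replaces a 2-form by an alternating bilinear
    function of two rows, on which calculations are lighter; [bilinear2_form] and [form_bilinear2]
    pass back and forth. *)
Definition bilinear2 n (w : 'M[R]_(2, n) -> R) (B : 'rV[R]_n -> 'rV[R]_n -> R) :=
  [/\ forall A, w A = B (row ord0 A) (row ord_max A),
      forall a u u' v, B (a *: u + u') v = a * B u v + B u' v,
      forall a u v v', B u (a *: v + v') = a * B u v + B u v' &
      forall u, B u u = 0].

Lemma ord2P (i : 'I_2) : i = ord0 \/ i = ord_max.
Proof. by case: i => -[|[|]]//= i; [left|right]; apply: val_inj. Qed.

Lemma bilinear2_form n (w : 'M[R]_(2, n) -> R) B : bilinear2 w B ->
  Defs.multilinear w /\ Defs.alternating w.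
Proof.
move=> [wE Bl Br B0]; split.
  move=> A A' C i b c; have [->|->] := ord2P i.
    rewrite !row'2_0 !wE => -> -> ->.
    rewrite Bl -[in LHS](addr0 (c *: _)) Bl.
    by have := Bl (- 1) 0 0 (row ord_max A); rewrite scaler0 add0r mulN1r addNr => ->; rewrite addr0.
  rewrite !row'2_1 !wE => -> -> ->.
  rewrite Br -[in LHS](addr0 (c *: _)) Br.
  by have := Br (- 1) (row ord0 A) 0 0; rewrite scaler0 add0r mulN1r addNr => ->; rewrite addr0.
move=> A i j; have [->|->] := ord2P i; have [->|->] := ord2P j; rewrite ?eqxx// => _ rA.
  by rewrite wE rA B0.
by rewrite wE rA B0.
Qed.

(** [col_mx u v] has [1 + 1] rows; the definition fixes the convertible type with 2 rows that
    2-forms expect. *)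
Definition pair_mx n (u v : 'rV[R]_n) : 'M[R]_(2, n) := col_mx u v.

Lemma row0_pair n (u v : 'rV[R]_n) : row ord0 (pair_mx u v) = u.
Proof.
apply/rowP => j; rewrite mxE -(col_mxEu u v 0 j); congr (_ _ j).
exact: val_inj.
Qed.

Lemma row1_pair n (u v : 'rV[R]_n) : row ord_max (pair_mx u v) = v.
Proof.
apply/rowP => j; rewrite mxE -(col_mxEd u v 0 j); congr (_ _ j).
exact: val_inj.
Qed.

Lemma pair_row n (A : 'M[R]_(2, n)) : pair_mx (row ord0 A) (row ord_max A) = A.
Proof.
apply/row_matrixP => i; have [->|->] := ord2P i; first exact: row0_pair.
exact: row1_pair.
Qed.

Lemma form_bilinear2 n (w : 'M[R]_(2, n) -> R) :
  Defs.multilinear w -> Defs.alternating w ->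
  bilinear2 w (fun u v => w (pair_mx u v)).
Proof.
move=> wM wA; split.
- by move=> A; rewrite pair_row.
- move=> a u u' v.
  by rewrite (wM _ (pair_mx u v) (pair_mx u' v) ord0 a 1) ?mul1r// ?row'2_0
    ?row0_pair ?row1_pair ?scale1r.
- move=> a u v v'.
  by rewrite (wM _ (pair_mx u v) (pair_mx u v') ord_max a 1) ?mul1r// ?row'2_1
    ?row0_pair ?row1_pair ?scale1r.
- by move=> u; apply: (wA _ ord0 ord_max) => //; rewrite row0_pair row1_pair.
Qed.

Lemma bilinear2B n (w w' : 'M[R]_(2, n) -> R) B B' :
  bilinear2 w B -> bilinear2 w' B' ->
  bilinear2 (fun A => w A - w' A) (fun u v => B u v - B' u v).
Proof.
move=> [wE Bl Br B0] [wE' Bl' Br' B0']; split=> *.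
- by rewrite wE wE'.
- by rewrite Bl Bl'; ring.
- by rewrite Br Br'; ring.
- by rewrite B0 B0' subr0.
Qed.

Lemma bilinear2_antisym n (w : 'M[R]_(2, n) -> R) B u v :
  bilinear2 w B -> B u v = - B v u.
Proof.
move=> [_ Bl Br B0]; have := B0 (1 *: u + v).
by rewrite Bl !scale1r -(scale1r u) !Br !scale1r !B0; lra.
Qed.

Lemma bilinear2_lsubmx n m (w : 'M[R]_(2, n) -> R) B : bilinear2 w B ->
  bilinear2 (fun A : 'M[R]_(2, n + m) => w (lsubmx A))
            (fun u v => B (lsubmx u) (lsubmx v)).
Proof.
have rl (A : 'M[R]_(2, n + m)) i : row i (lsubmx A) = lsubmx (row i A).
  by apply/rowP => j; rewrite !mxE.
move=> [wE Bl Br B0]; split=> [A|a u u' v|a u v v'|u].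
- by rewrite wE !rl.
- by rewrite linearP Bl.
- by rewrite linearP Br.
- exact: B0.
Qed.

Definition gram n (B : 'rV[R]_n -> 'rV[R]_n -> R) : 'M[R]_n :=
  \matrix_(i, j) B (delta_mx 0 i) (delta_mx 0 j).

Lemma gramE n (w : 'M[R]_(2, n) -> R) B u v : bilinear2 w B ->
  B u v = (u *m gram B *m v^T) 0 0.
Proof.
move=> [_ Bl Br _].
have B0l y : B 0 y = 0.
  by have := Bl (-1) 0 0 y; rewrite scaler0 addr0 mulN1r addNr.
have B0r y : B y 0 = 0.
  by have := Br (-1) y 0 0; rewrite scaler0 addr0 mulN1r addNr.
have Blsum (I : Type) (r : seq I) (F : I -> R) (G : I -> 'rV[R]_n) y :
    B (\sum_(i <- r) F i *: G i) y = \sum_(i <- r) F i * B (G i) y.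
  by elim: r => [|i r IH]; rewrite ?big_nil// !big_cons Bl IH.
have Brsum (I : Type) (r : seq I) (F : I -> R) (G : I -> 'rV[R]_n) y :
    B y (\sum_(i <- r) F i *: G i) = \sum_(i <- r) F i * B y (G i).
  by elim: r => [|i r IH]; rewrite ?big_nil// !big_cons Br IH.
rewrite {1}(row_sum_delta u) Blsum -mulmxA mxE; apply: eq_bigr => i _.
congr (_ * _); rewrite {1}(row_sum_delta v) Brsum mxE; apply: eq_bigr => j _.
by rewrite !mxE mulrC.
Qed.

Lemma extd1_bilinear2 n (U : set 'rV[R]_n) (b : 'rV[R]_n -> 'M[R]_(1, n) -> R) x :
  open U -> U x -> (forall v, smooth_on U (b ^~ v)) ->
  (forall y, U y -> forall a u v, b y (a *: u + v) = a * b y u + b y v) ->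
  bilinear2 (extd b x) (fun u v => 'D_u (b ^~ v) x - 'D_v (b ^~ u) x).
Proof.
move=> oU Ux sb lb.
have db v : differentiable (b ^~ v) x by exact: smooth_on_differentiable (sb v) Ux.
have Dl a u u' v : 'D_(a *: u + u') (b ^~ v) x = a * 'D_u (b ^~ v) x + 'D_u' (b ^~ v) x.
  by rewrite !(deriveE _ (db v)) linearP.
have Dr a u v v' : 'D_u (b ^~ (a *: v + v')) x = a * 'D_u (b ^~ v) x + 'D_u (b ^~ v') x.
  have d1 := diff_derivable (v := u) (db v); have d2 := diff_derivable (v := u) (db v').
  have E := deriveD (@derivableZ _ _ _ _ a _ _ d1) d2; rewrite (deriveZ a d1) in E.
  rewrite -[RHS]E.
  by apply: near_eq_derive; apply: (open_near oU Ux) => y Uy; rewrite lb.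
split=> [A|a u u' v|a u v v'|u].
- exact: extd1E.
- by rewrite Dl Dr; ring.
- by rewrite Dl Dr; ring.
- by rewrite subrr.
Qed.

(** [extd] differentiates along constant vectors, and a change of variables does not keep vectors
    constant. So [b] is expanded as the sum over [j] of the [j]-th component of ['D_v T] times a
    coefficient of [b'] at [T y], and the product rule produces second derivatives of [T] besides
    the expected terms. *)
Lemma extd1_pullback n m (U : set 'rV[R]_n) (U' : set 'rV[R]_m)
    (b : 'rV[R]_n -> 'M[R]_(1, n) -> R) (b' : 'rV[R]_m -> 'M[R]_(1, m) -> R)
    (T : 'rV[R]_n -> 'rV[R]_m) x (A : 'M[R]_(2, n)) :
  open U -> open U' -> U x -> (forall y, U y -> U' (T y)) -> smooth_on U T ->
  (forall v, smooth_on U' (b' ^~ v)) ->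
  (forall y, U' y -> forall a u v, b' y (a *: u + v) = a * b' y u + b' y v) ->
  (forall y, U y -> forall v, b y v = b' (T y) ('D_v T y)) ->
  extd b x A = extd b' (T x) (A *m jacobian T x).
Proof.
move=> oU oU' Ux UT sT sb' lb' bT.
have dT y (Uy : U y) := smooth_on_differentiable sT Uy.
have db' v : differentiable (b' ^~ v) (T x).
  by apply: smooth_on_differentiable (sb' v) _; exact: UT.
have b'sum y v : U' y -> b' y v = \sum_j v 0 j * b' y (delta_mx 0 j).
  move=> U'y.
  have b0 : b' y 0 = 0.
    by have := lb' y U'y (-1) 0 0; rewrite scaler0 addr0 mulN1r addNr.
  rewrite {1}(row_sum_delta v); elim: (index_enum _) => [|j r IH].
    by rewrite !big_nil.
  by rewrite !big_cons lb'// IH.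
have Db u v : 'D_u (b ^~ v) x =
    \sum_j ('D_v T x 0 j * 'D_('D_u T x) (b' ^~ (delta_mx 0 j)) (T x) +
            b' (T x) (delta_mx 0 j) * 'D_u ('D_v (fun y => T y 0 j)) x).
  pose F j y := 'D_v T y 0 j * b' (T y) (delta_mx 0 j).
  have dF j : is_derive x u (F j) ('D_v T x 0 j * 'D_('D_u T x) (b' ^~ (delta_mx 0 j)) (T x) +
            b' (T x) (delta_mx 0 j) * 'D_u ('D_v (fun y => T y 0 j)) x).
    have d1 : differentiable (fun y => 'D_v T y 0 j) x.
      apply: smooth_on_differentiable Ux; apply: smooth_on_coord => //.
      exact: smooth_on_derive.
    have d2 : differentiable (b' ^~ (delta_mx 0 j) \o T) x.
      by apply: differentiable_comp => //; exact: dT.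
    have dM : is_derive x u (F j) _ :=
      is_deriveM (derivableP (diff_derivable (v := u) d1))
      (derivableP (diff_derivable (v := u) d2)).
    apply: (is_derive_eq dM); congr (_ * _ + _ * _).
      by rewrite derive_comp//; exact: dT.
    apply: near_eq_derive; apply: (open_near oU Ux) => y Uy.
    by rewrite derive_coord//; exact: dT.
  have := is_derive_sum dF; move=> [_ <-].
  apply: near_eq_derive; apply: (open_near oU Ux) => y Uy.
  rewrite bT// b'sum; last exact: UT.
  by rewrite fct_sumE.
have Db'E u v : \sum_j 'D_v T x 0 j * 'D_('D_u T x) (b' ^~ (delta_mx 0 j)) (T x) =
    'D_('D_u T x) (b' ^~ ('D_v T x)) (T x).
  have dF j : is_derive (T x) ('D_u T x) (fun y => 'D_v T x 0 j * b' y (delta_mx 0 j))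
      ('D_v T x 0 j * 'D_('D_u T x) (b' ^~ (delta_mx 0 j)) (T x)).
    exact: (is_deriveZ _ (derivableP (diff_derivable (db' _)))).
  have := is_derive_sum dF; move=> [_ <-].
  apply: near_eq_derive; apply: (open_near oU' (UT _ Ux)) => y U'y.
  by rewrite (b'sum y)// fct_sumE.
rewrite !extd1E !row_mul -!(deriveEjacobian _ (dT x Ux)) -!Db'E !Db.
rewrite -!sumrB; apply: eq_bigr => j _.
have sTj : smooth_on U (fun y => T y 0 j) by exact: smooth_on_coord.
(* The second derivatives of the change of variables cancel by symmetry. *)
have cancel_mixed (p q e d d' : R) : d = d' -> (p + e * d) - (q + e * d') = p - q.
  by move=> ->; rewrite opprD addrACA subrr addr0.
exact: cancel_mixed (schwarz (row ord_max A) (row ord0 A) oU Ux sTj).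
Qed.

(** The alternating sum expands into six second derivatives that cancel in three pairs by
    symmetry. *)
Lemma extd_extd1 n (U : set 'rV[R]_n) (b : 'rV[R]_n -> 'M[R]_(1, n) -> R) x
    (A : 'M[R]_(3, n)) : open U -> U x -> (forall v, smooth_on U (b ^~ v)) ->
  extd (extd b) x A = 0.
Proof.
move=> oU Ux sb.
have D u v w : 'D_w (fun y => 'D_u (b ^~ v) y - 'D_v (b ^~ u) y) x =
    'D_w ('D_u (b ^~ v)) x - 'D_w ('D_v (b ^~ u)) x.
  have d u' v' : derivable ('D_u' (b ^~ v')) x w.
    by apply: diff_derivable; apply: smooth_on_differentiable Ux; exact: smooth_on_derive.
  by rewrite -deriveB.
have E (k : 'I_3) : 'D_(row k A) (fun y => extd b y (row' k A)) x =
   'D_(row k A) ('D_(row ord0 (row' k A)) (b ^~ (row ord_max (row' k A)))) x -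
   'D_(row k A) ('D_(row ord_max (row' k A)) (b ^~ (row ord0 (row' k A)))) x.
  rewrite -D; congr ('D_ _ _ x); apply/funext => y; exact: extd1E.
pose i0 : 'I_3 := ord0; pose i1 : 'I_3 := lift ord0 ord0; pose i2 : 'I_3 := ord_max.
have r (k : 'I_3) (j : 'I_2) (l : 'I_3) : lift k j = l -> row j (row' k A) = row l A.
  by move=> <-; apply/rowP => z; rewrite !mxE.
have S (i j k : 'I_3) := schwarz (row i A) (row j A) oU Ux (sb (row k A)).
have cancel (a b' c a' b'' c' : R) : a = a' -> b' = b'' -> c = c' ->
    (a - b') - (a' - c) + (b'' - c') = 0.
  by move=> -> -> ->; ring.
have alternating_sum3 (F : 'I_3 -> R) :
    \sum_(i < 3) (-1) ^+ i * F i = F i0 - F i1 + F i2.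
  rewrite big_ord_recr big_ord_recr big_ord1.
  rewrite [widen_ord _ (widen_ord _ _)](_ : _ = i0); last exact: val_inj.
  rewrite [widen_ord _ _](_ : _ = i1); last exact: val_inj.
  by rewrite expr0 expr1 sqrrN expr1n !mul1r mulN1r.
apply: (etrans (alternating_sum3
  (fun k => 'D_(row k A) (fun y => extd b y (row' k A)) x))).
rewrite !E.
rewrite (r i0 ord0 i1) ?(r i0 ord_max i2) ?(r i1 ord0 i0) ?(r i1 ord_max i2)
  ?(r i2 ord0 i0) ?(r i2 ord_max i1); try exact: val_inj.
exact: cancel (S i1 i0 i2) (S i2 i0 i1) (S i2 i1 i0).
Qed.

Lemma extdB k n (w w' : 'rV[R]_n -> 'M[R]_(k, n) -> R) x v :
  (forall A, differentiable (w ^~ A) x) -> (forall A, differentiable (w' ^~ A) x) ->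
  extd (fun y A => w y A - w' y A) x v = extd w x v - extd w' x v.
Proof.
move=> dw dw'; rewrite /extd -sumrB; apply: eq_bigr => i _.
rewrite -mulrBr -deriveB//; apply: diff_derivable; [exact: dw|exact: dw'].
Qed.

(** In coordinates [lsubmx] is the projection of M x R to M. It is linear, so pulling back along it
    commutes with [extd] in every degree without any second derivative. *)
Lemma extd_lsubmx k n m (w : 'rV[R]_n -> 'M[R]_(k, n) -> R) (x : 'rV[R]_(n + m))
    (v : 'M[R]_(k.+1, n + m)) :
  (forall A, differentiable (w ^~ A) (lsubmx x)) ->
  extd (fun y A => w (lsubmx y) (lsubmx A)) x v = extd w (lsubmx x) (lsubmx v).
Proof.
move=> dw; rewrite /extd; apply: eq_bigr => i _; congr (_ * _).
have -> : row' i (lsubmx v) = lsubmx (row' i v) by apply/matrixP => a b; rewrite !mxE.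
have -> : row i (lsubmx v) = lsubmx (row i v) by apply/matrixP => a b; rewrite !mxE.
have dl : differentiable (lsubmx : 'rV[R]_(n + m) -> 'rV[R]_n) x.
  exact: differentiable_lsubmx.
pose L : 'rV[R]_(n + m) -> 'rV[R]_n := lsubmx.
apply: (etrans (@derive_comp R n _ _ L (w ^~ (lsubmx (row' i v))) x (row i v) dl (dw _))).
have -> // : 'D_(row i v) L x = lsubmx (row i v).
rewrite (deriveE _ dl); apply: (congr1 (fun f => f (row i v)) (y := L)).
by apply: diff_lin; exact: continuous_lsubmx.
Qed.

End exterior_derivative.

(** * Open neighbourhoods of the zero section in M x R *)

Section subspace_of_product.
Context {R : realType} {T : topologicalType} (U : set (T * R)).
Implicit Types (w : set_type U).

Lemma set_type_nbhsE w (A : set (set_type U)) : nbhs w A ->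
  exists2 B : set (T * R), open B /\ B (\val w) & \val @^-1` B `<=` A.
Proof.
by move=> [_ [/= [B oB <-] Bw] BA]; exists B.
Qed.

Lemma continuous_set_type (S : topologicalType) (f : S -> set_type U) x :
  {for x, continuous (\val \o f)} -> {for x, continuous f}.
Proof.
move=> cf A /set_type_nbhsE[B [oB Bfx] BA].
have : nbhs x ((\val \o f) @^-1` B) by apply: cf; exact: open_nbhs_nbhs.
by apply: filterS => y; exact: BA.
Qed.

Lemma continuous_val1 : continuous (fun w => (\val w).1).
Proof.
move=> w; apply: (@continuous_comp _ _ _ (\val : set_type U -> _) fst).
  exact: initial_continuous.
exact: cvg_fst.
Qed.

Lemma continuous_val2 : continuous (fun w => (\val w).2).
Proof.
move=> w; apply: (@continuous_comp _ _ _ (\val : set_type U -> _) snd).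
  exact: initial_continuous.
exact: cvg_snd.
Qed.

Lemma cluster_continuous (S S' : topologicalType) (f : S -> S') (p q : S) :
  continuous f -> cluster (nbhs p) q -> cluster (nbhs (f p)) (f q).
Proof.
move=> cf clpq A B nA nB.
by have [x [Ax Bx]] := clpq _ _ (cf p A nA) (cf q B nB); exists (f x).
Qed.

Lemma set_type_hausdorff : hausdorff_space T -> hausdorff_space (set_type U).
Proof.
move=> hT w w' cl; apply: val_inj; apply: injective_projections.
  by apply: hT; exact: (cluster_continuous continuous_val1).
by apply: (@norm_hausdorff R R); exact: (cluster_continuous continuous_val2).
Qed.

Lemma set_type_second_countable : @second_countable T ->
  @second_countable (set_type U).
Proof.
move=> [B cB [oB bB]].
(* Boxes made of a member of the base of [T] and an interval with rational ends, cut down to [U]. *)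
pose F (i : set T * (rat * rat)) : set (set_type U) :=
  [set w | i.1 (\val w).1 /\ ratr i.2.1 < (\val w).2 < ratr i.2.2].
exists (F @` (B `*` setT)).
  apply: sub_countable (card_image_le _ _) _; apply: countableX => //.

split=> [_ [[b [q1 q2]] [Bb _] <-]|w A /set_type_nbhsE[C [oC Cw] CA]].
  have o1 : open ((fun w : set_type U => (\val w).1) @^-1` b).
    by apply: open_comp => [w _|]; [exact: continuous_val1|exact: oB].
  have o2 : open ((fun w : set_type U => (\val w).2) @^-1` `]ratr q1, ratr q2[).
    by apply: open_comp => [w _|]; [exact: continuous_val2|exact: itv_open].
  rewrite (_ : F _ = (fun w : set_type U => (\val w).1) @^-1` b `&`
    ((fun w : set_type U => (\val w).2) @^-1` `]ratr q1, ratr q2[)).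
    exact: openI.
  by apply/seteqP; split=> w /=; rewrite in_itv.
have [[C1 C2] /= [nC1 nC2] C12] : nbhs (\val w) C by exact: open_nbhs_nbhs.
have [b [Bb bw] bC1] := bB _ _ nC1.
have [e /= e0 eC2] := (nbhs_ballP _ _).1 nC2.
have [q1] := @rat_in_itvoo R ((\val w).2 - e) (\val w).2 ltac:(lra).
have [q2] := @rat_in_itvoo R (\val w).2 ((\val w).2 + e) ltac:(lra).
rewrite !in_itv/= => /andP[q21 q22] /andP[q11 q12].
exists (F (b, (q1, q2))); first split.
- by exists (b, (q1, q2)).
- by split=> //=; rewrite q12 q21.
- move=> w' [/= bw' /andP[w1 w2]]; apply: CA => /=; apply: C12; split=> /=.
    exact: bC1.
  apply: eC2; rewrite -ball_normE/= ltr_norml.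
  by apply/andP; split; lra.
Qed.

End subspace_of_product.

Section slab_chart.
Context {R : realType} {n : nat} {T : topologicalType} {U : set (T * R)}.
Hypotheses (oU : open U) (U0 : forall p, U (p, 0)).
Implicit Types (c : chart R n T) (y : 'rV[R]_(n + 1)) (w : set_type U).

Local Notation vl := (\val : set_type U -> T * R).

Definition slab_pt (z : T * R) (Uz : U z) : set_type U := exist _ z (mem_set Uz).

Lemma val_slab w : U (\val w).
Proof. exact: set_mem (valP w). Qed.

Definition height y : R := rsubmx y 0 0.

Lemma height_row_mx (x : 'rV[R]_n) (s : R) : height (row_mx x s%:M) = s.
Proof. by rewrite /height row_mxKr mxE. Qed.

Lemma row_mx_height y : row_mx (lsubmx y) (height y)%:M = y.
Proof.
rewrite -[RHS]hsubmxK; congr row_mx; apply/rowP => i.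
by rewrite ord1 [LHS]mxE eqxx mulr1n.
Qed.

Definition slab_coord c (z : T * R) : 'rV[R]_(n + 1) := row_mx (cmap c z.1) z.2%:M.

(* Junk outside the lifted target; [U0] is only used to provide a default. *)
Definition slab_inv c y : set_type U :=
  if pselect (U (cinv c (lsubmx y), height y)) is left e then slab_pt e
  else slab_pt (U0 (cinv c 0)).

Definition slab_dom c : set (set_type U) := [set w | cdom c (\val w).1].

Lemma slab_invE c y : U (cinv c (lsubmx y), height y) ->
  \val (slab_inv c y) = (cinv c (lsubmx y), height y).
Proof. by move=> Uy; rewrite /slab_inv; case: pselect. Qed.

Lemma slab_coordK c w : cdom c (\val w).1 ->
  slab_inv c (slab_coord c (\val w)) = w.
Proof.
move=> cw; apply: val_inj; have := @slab_invE c (slab_coord c (\val w)).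
rewrite /slab_coord row_mxKl height_row_mx cmapKp// -surjective_pairing => -> //.
exact: val_slab.
Qed.

(** [U] need not be a product, so the target is only a part of the cylinder over [ctarget c]. In
    this form it is open by continuity of the base point and the height. *)
Lemma slab_targetE c : (slab_coord c \o vl) @` slab_dom c =
  [set y | ctarget c (lsubmx y) /\ U (cinv c (lsubmx y), height y)].
Proof.
apply/seteqP; split=> [_ [w cw <-]|y [cy Uy]].
  rewrite /= /slab_coord row_mxKl height_row_mx cmapKp// -surjective_pairing.
  by split; [exact: ctarget_cmap|exact: val_slab].
exists (slab_pt Uy); first exact: cdom_cinv.
by rewrite /= /slab_coord/= cinvK// row_mx_height.
Qed.

Lemma continuous_height : continuous height.
Proof.
move=> y; apply: (@continuous_comp _ _ _ rsubmx (fun z : 'rV[R]_1 => z 0 0)).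
  exact: continuous_rsubmx.
exact: coord_continuous.
Qed.

Lemma continuous_slab_base c y : ctarget c (lsubmx y) ->
  {for y, continuous (fun y => (cinv c (lsubmx y), height y))}.
Proof.
move=> cy.
have c1 : {for y, continuous (cinv c \o lsubmx)}.
  apply: (@continuous_comp _ _ _ lsubmx (cinv c)); first exact: continuous_lsubmx.
  exact: cinv_continuous.
exact: cvg_pair c1 (@continuous_height y).
Qed.

Lemma slab_dom_open c : open (slab_dom c).
Proof.
apply: (@open_comp _ _ (fun w : set_type U => (\val w).1) (cdom c)).
  by move=> w _; exact: continuous_val1.
exact: cdom_open.
Qed.

Lemma slab_target_open c : open ((slab_coord c \o vl) @` slab_dom c).
Proof.
rewrite slab_targetE.
apply: (@open_setI_preimage _ _ (lsubmx @^-1` ctarget c)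
  (fun y => (cinv c (lsubmx y), height y)) U) => //.
- apply: (@open_comp _ _ lsubmx (ctarget c)); last exact: open_ctarget.
  by move=> y _; exact: continuous_lsubmx.
- by move=> y; exact: continuous_slab_base.
Qed.

Lemma slab_cmapK c : {in slab_dom c, cancel (slab_coord c \o vl) (slab_inv c)}.
Proof. by move=> w; rewrite inE => cw; exact: slab_coordK. Qed.

Lemma continuous_rV (S : topologicalType) m (f : S -> 'rV[R]_m) (x : S) :
  (forall j, {for x, continuous (fun s => f s 0 j)}) -> {for x, continuous f}.
Proof.
move=> cf A [P nP PA]; have : \forall s \near x, forall j, P 0 j (f s 0 j).
  by apply: filter_forall => j; exact: cf.
by apply: filterS => s Ps; apply: PA => i j; rewrite ord1.
Qed.

Lemma continuous_slab_coord c z : cdom c z.1 -> {for z, continuous (slab_coord c)}.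
Proof.
move=> cz; apply: continuous_rV => j; rewrite -[j]splitK; case: (fintype.split j) => k /=.
  rewrite (_ : (fun s => _) = (fun x => cmap c x 0 k) \o fst); last first.
    by apply/funext => s; rewrite /slab_coord row_mxEl.
  apply: continuous_comp; first exact: cvg_fst.
  apply: (@continuous_comp _ _ _ (cmap c) (fun z : 'rV[R]_n => z 0 k)).
    exact: cmap_continuous.
  exact: coord_continuous.
rewrite (_ : (fun s => _) = snd); first exact: cvg_snd.
by apply/funext => s; rewrite /slab_coord row_mxEr ord1 mxE.
Qed.

Lemma slab_cmap_continuous c w : slab_dom c w ->
  {for w, continuous (slab_coord c \o vl)}.
Proof.
move=> cw; apply: continuous_comp; first exact: initial_continuous.
exact: continuous_slab_coord.
Qed.

Lemma slab_inv_continuous c y : ((slab_coord c \o vl) @` slab_dom c) y ->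
  {for y, continuous (slab_inv c)}.
Proof.
move=> ty; have := @slab_target_open c; rewrite slab_targetE in ty * => oT.
apply: continuous_set_type.
have e : \forall z \near y, (cinv c (lsubmx z), height z) = (vl \o slab_inv c) z.
  by apply: (open_near oT ty) => z [_ Uz]; rewrite /= slab_invE.
apply: (cvg_trans (near_eq_cvg e)); rewrite /= slab_invE; last exact: ty.2.
by apply: continuous_slab_base; exact: ty.1.
Qed.

Definition slab_chart c : chart R (n + 1) (set_type U) :=
  Chart (@slab_dom_open c) (@slab_target_open c) (@slab_cmapK c)
    (@slab_cmap_continuous c) (@slab_inv_continuous c).

End slab_chart.

(** * Smooth maps and Jacobians on a product with the line *)

Section product_calculus.
Context {R : realType}.

Lemma smooth_on_row_mx (V : normedModType R) (D : set V) m k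
    (f : V -> 'rV[R]_m) (g : V -> 'rV[R]_k) : open D ->
  smooth_on D f -> smooth_on D g -> smooth_on D (fun x => row_mx (f x) (g x)).
Proof.
move=> oD sf sg; apply: smooth_on_rV => // j.
rewrite -(splitK j); case: (fintype.split j) => i /=.
  apply: (@smooth_on_eq _ _ _ _ (fun x => f x 0 i)) => //.
    by move=> x _; rewrite row_mxEl.
  exact: smooth_on_coord.
apply: (@smooth_on_eq _ _ _ _ (fun x => g x 0 i)) => //.
  by move=> x _; rewrite row_mxEr.
exact: smooth_on_coord.
Qed.

Lemma derive_row_mx (V : normedModType R) m k (f : V -> 'rV[R]_m)
    (g : V -> 'rV[R]_k) x v :
  differentiable f x -> differentiable g x ->
  differentiable (fun x => row_mx (f x) (g x)) x ->
  'D_v (fun x => row_mx (f x) (g x)) x = row_mx ('D_v f x) ('D_v g x).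
Proof.
move=> df dg d; apply/rowP => j; rewrite derive_coord//.
rewrite -(splitK j); case: (fintype.split j) => i /=.
  rewrite row_mxEl derive_coord//; congr ('D_v _ x).
  by apply/funext => y; rewrite row_mxEl.
rewrite row_mxEr derive_coord//; congr ('D_v _ x).
by apply/funext => y; rewrite row_mxEr.
Qed.

Context {n : nat}.
Implicit Types (y v : 'rV[R]_(n + 1)).

Lemma smooth_lsubmx (D : set 'rV[R]_(n + 1)) :
  smooth_on D (lsubmx : 'rV[R]_(n + 1) -> 'rV[R]_n).
Proof. by apply: smooth_on_linear; exact: continuous_lsubmx. Qed.

Lemma smooth_height (D : set 'rV[R]_(n + 1)) : open D ->
  smooth_on D (height : 'rV[R]_(n + 1) -> R).
Proof.
move=> oD; apply: (smooth_on_coord (f := rsubmx : 'rV[R]_(n + 1) -> 'rV[R]_1)) => //.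
by apply: smooth_on_linear; exact: continuous_rsubmx.
Qed.

Lemma derive_lsubmx y v :
  'D_v (lsubmx : 'rV[R]_(n + 1) -> 'rV[R]_n) y = lsubmx v.
Proof.
rewrite deriveE; last exact: differentiable_lsubmx.
apply: (congr1 (fun f => f v) (y := lsubmx)).
by apply: diff_lin; exact: continuous_lsubmx.
Qed.

Lemma derive_rsubmx y v :
  'D_v (rsubmx : 'rV[R]_(n + 1) -> 'rV[R]_1) y = rsubmx v.
Proof.
pose L : 'rV[R]_(n + 1) -> 'rV[R]_1 := rsubmx.
rewrite -/L deriveE; last exact: differentiable_rsubmx.
apply: (congr1 (fun f => f v) (y := L)).
by apply: diff_lin; exact: continuous_rsubmx.
Qed.

Lemma derive_height y v : 'D_v (height : 'rV[R]_(n + 1) -> R) y = height v.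
Proof.
have dr := @differentiable_rsubmx R 1 n 1 y.
rewrite /height -(derive_coord (f := rsubmx : 'rV[R]_(n + 1) -> 'rV[R]_1))//.
by rewrite derive_rsubmx.
Qed.

Lemma scalar_height y : (height y)%:M = rsubmx y.
Proof. by apply/rowP => i; rewrite ord1 [LHS]mxE eqxx mulr1n. Qed.

Definition cylinder (D : set 'rV[R]_n) : set 'rV[R]_(n + 1) := lsubmx @^-1` D.

Lemma open_cylinder D : open D -> open (cylinder D).
Proof.
move=> oD; apply: (@open_comp _ _ (lsubmx : 'rV[R]_(n + 1) -> 'rV[R]_n)) => //.
by move=> y _; exact: continuous_lsubmx.
Qed.

Lemma smooth_on_cylinder D (f : 'rV[R]_n -> R) : open D -> smooth_on D f ->
  smooth_on (cylinder D) (fun y => f (lsubmx y)).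
Proof.
move=> oD sf; apply: (smooth_on_comp (open_cylinder oD) _ (smooth_lsubmx _) sf).
by [].
Qed.

Lemma smooth_on_cylinder_rV m D (f : 'rV[R]_n -> 'rV[R]_m) : open D ->
  smooth_on D f -> smooth_on (cylinder D) (fun y => f (lsubmx y)).
Proof.
move=> oD sf.
apply: (smooth_on_comp_rV (open_cylinder oD) oD _ (smooth_lsubmx _) sf).
by [].
Qed.

(** The product of [f] with the identity of the line, the shape of every change of lifted charts; it
    is unrelated to the suspension of a return map. *)
Definition suspension (f : 'rV[R]_n -> 'rV[R]_n) y : 'rV[R]_(n + 1) :=
  row_mx (f (lsubmx y)) (height y)%:M.

Lemma smooth_on_suspension D f : open D -> smooth_on D f ->
  smooth_on (cylinder D) (suspension f).
Proof.
move=> oD sf; have oC := open_cylinder oD; apply: smooth_on_row_mx => //.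
  exact: smooth_on_cylinder_rV.
apply: (@smooth_on_eq _ _ _ _ rsubmx) => //.
  by move=> y _; rewrite scalar_height.
by apply: smooth_on_linear; exact: continuous_rsubmx.
Qed.

Lemma jacobian_suspension D f y : open D -> smooth_on D f -> D (lsubmx y) ->
  jacobian (suspension f) y = block_mx (jacobian f (lsubmx y)) 0 0 1%:M.
Proof.
move=> oD sf Dy; have oC := open_cylinder oD.
have ds := smooth_on_differentiable (smooth_on_suspension oD sf) (Dy : cylinder D y).
have df := smooth_on_differentiable sf Dy.
apply/row_matrixP => i; rewrite !rowE -(deriveEjacobian _ ds).
set v := delta_mx _ _.
have dl := @differentiable_lsubmx R 1 n 1 y.
have dr := @differentiable_rsubmx R 1 n 1 y.
have sE : suspension f = fun y => row_mx ((f \o lsubmx) y) (rsubmx y).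
  by apply/funext => z; rewrite /suspension scalar_height.
rewrite sE derive_row_mx//; [|exact: differentiable_comp|by rewrite -sE].
rewrite derive_comp// derive_lsubmx deriveEjacobian//.
rewrite derive_rsubmx.
by rewrite -{3}(hsubmxK v) mul_row_block !mulmx0 addr0 add0r mulmx1.
Qed.

Lemma jacobian_near_eq m k (f g : 'rV[R]_m -> 'rV[R]_k) x :
  (\forall z \near x, f z = g z) -> differentiable f x ->
  jacobian f x = jacobian g x.
Proof.
move=> fg df; have dg := differentiable_near_eq fg df.
apply/row_matrixP => i.
apply: (etrans (rowE _ _)); apply: (etrans _ (esym (rowE _ _))).
apply: (etrans (esym (deriveEjacobian _ df))).
by apply: (etrans _ (deriveEjacobian _ dg)); exact: near_eq_derive.
Qed.

End product_calculus.

(** * The manifold structure on an open neighbourhood of the zero section *)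

Section slab_manifold.
Context {R : realType} {n : nat} {M : smooth_manifold R n} {U : set (M * R)}.
Hypotheses (oU : open U) (U0 : forall p, U (p, 0)).
Implicit Types (c : chart R n M) (y : 'rV[R]_(n + 1)) (w : set_type U).

Local Notation pc := (slab_chart oU U0).

Definition slab_atlas : set (chart R (n + 1) (set_type U)) := pc @` atlas M.

Lemma slab_cover w :
  exists2 c' : chart R (n + 1) (set_type U), slab_atlas c' & cdom c' w.
Proof.
have [c ac cw] := atlas_cover (\val w).1.
by exists (pc c) => //; exists c.
Qed.

Lemma slab_overlap c c' y :
  (cmap (pc c) @` (cdom (pc c) `&` cdom (pc c'))) y ->
  (cmap c @` (cdom c `&` cdom c')) (lsubmx y) /\
  transition (pc c) (pc c') y = suspension (transition c c') y.
Proof.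
move=> [w [cw c'w] <-]; rewrite /transition/= slab_coordK//.
rewrite /suspension /slab_coord row_mxKl height_row_mx /= cmapKp//.
by split=> //; exists (\val w).1.
Qed.

Lemma slab_compatible (c1 c2 : chart R (n + 1) (set_type U)) :
  slab_atlas c1 -> slab_atlas c2 -> compatible c1 c2.
Proof.
move=> [c ac <-] [c' ac' <-].
have oO : open (cmap (pc c) @` (cdom (pc c) `&` cdom (pc c'))).
  by apply: open_overlap; exact: cdom_open.
have oD : open (cmap c @` (cdom c `&` cdom c')).
  by apply: open_overlap; exact: cdom_open.
apply: (smooth_on_eq oO (f := suspension (transition c c'))).
  by move=> y /slab_overlap[_ ->].
apply: smooth_on_mono (smooth_on_suspension oD (smooth_transition ac ac')).
by move=> y /slab_overlap[].
Qed.

Definition slab : smooth_manifold R (n + 1) :=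
  SmoothManifold slab_cover slab_compatible
    (@set_type_hausdorff _ _ U (@manifold_hausdorff _ _ M))
    (@set_type_second_countable _ _ U (@manifold_second_countable _ _ M)).

(* Coordinate expressions on the slab are indexed by its own charts, but ours are
   given by the charts of [M]: choice recovers the chart of [M] from its lift. *)
Definition slab_rep (Y : Type) (d : Y) (F : chart R n M -> Y)
    (c' : chart R (n + 1) slab) : Y :=
  if pselect (exists c, atlas M c /\ pc c = c') is left e
  then F (projT1 (cid e)) else d.

(** A lifted chart is not known to determine the chart it comes from, so [c] must be the one that
    [slab_rep] chooses. The quantification over [Y] and [F] lets the same [c] serve for a form and a
    vector field at once. *)
Lemma slab_atlasP (c' : chart R (n + 1) slab) : atlas slab c' ->
  exists c, [/\ atlas M c, c' = pc c &
    forall (Y : Type) (d : Y) F, slab_rep d F c' = F c].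
Proof.
move=> [c0 ac0 c0E].
have e : exists c, atlas M c /\ pc c = c' by exists c0.
have [ac cE] := projT2 (cid e); exists (projT1 (cid e)); split=> // Y d F.
by rewrite /slab_rep; case: pselect => // e'; rewrite (Prop_irrelevance e' e).
Qed.

Lemma slab_jacobian c c' w : atlas M c -> atlas M c' ->
  cdom (pc c) w -> cdom (pc c') w ->
  jacobian (transition (pc c) (pc c')) (cmap (pc c) w) =
  block_mx (jacobian (transition c c') (cmap c (\val w).1)) 0 0 1%:M.
Proof.
move=> ac ac' cw c'w.
have oD : open (cmap c @` (cdom c `&` cdom c')).
  by apply: open_overlap; exact: cdom_open.
have oO : open (cmap (pc c) @` (cdom (pc c) `&` cdom (pc c'))).
  by apply: open_overlap; exact: cdom_open.
have Ow : (cmap (pc c) @` (cdom (pc c) `&` cdom (pc c'))) (cmap (pc c) w).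
  by exists w.
have ls : lsubmx (cmap (pc c) w) = cmap c (\val w).1 by exact: row_mxKl.
have Dw : (cmap c @` (cdom c `&` cdom c')) (lsubmx (cmap (pc c) w)).
  by rewrite ls; exists (\val w).1.
rewrite -ls -(jacobian_suspension oD (smooth_transition ac ac') Dw).
symmetry; apply: jacobian_near_eq.
  by apply: (open_near oO Ow) => y /slab_overlap[_ ->].
exact: (smooth_on_differentiable (smooth_on_suspension oD (smooth_transition ac ac'))).
Qed.

End slab_manifold.

(** * The symplectic thickening *)

Section thickening.
Context {R : realType} {n : nat} {M : smooth_manifold R n}.
Context (omega : diff_form M 2) (alpha : diff_form M 1) (X : vector_field M).
Implicit Types (c : chart R n M) (y u v : 'rV[R]_(n + 1)).

Local Notation C c := (cylinder (ctarget c)).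

Let openC c : open (C c).
Proof. exact: open_cylinder (open_ctarget c). Qed.

Definition thick_form1 c y (v : 'M[R]_(1, n + 1)) : R :=
  height y * df alpha c (lsubmx y) (lsubmx v).

(** The form Lambda of the overview, given on the whole cylinder over [ctarget c]; the open set on
    which it is symplectic is cut out by it afterwards. *)
Definition thick_form c y (A : 'M[R]_(2, n + 1)) : R :=
  df omega c (lsubmx y) (lsubmx A) - extd (thick_form1 c) y A.

Lemma form1_linear c x a (u v : 'rV[R]_n) : atlas M c -> ctarget c x ->
  df alpha c x (a *: u + v) = a * df alpha c x u + df alpha c x v.
Proof.
move=> ac cx.
rewrite (@df_multilinear R n M 1 alpha c ac x cx (a *: u + v) u v ord0 a 1) ?mul1r//.
- by rewrite !row_id scale1r.
- by rewrite [LHS]flatmx0 [RHS]flatmx0.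
- by rewrite [LHS]flatmx0 [RHS]flatmx0.
Qed.

Lemma thick_form1_linear c y a (u v : 'M[R]_(1, n + 1)) : atlas M c -> C c y ->
  thick_form1 c y (a *: u + v) = a * thick_form1 c y u + thick_form1 c y v.
Proof.
by move=> ac cy; rewrite /thick_form1 linearP form1_linear//; ring.
Qed.

Lemma smooth_thick_form1 c v : atlas M c -> smooth_on (C c) (thick_form1 c ^~ v).
Proof.
move=> ac; have oC := @openC c; apply: smooth_onM => //; first exact: smooth_height.
apply: (@smooth_on_cylinder _ _ _ (df alpha c ^~ (lsubmx v))).
  exact: open_ctarget.
exact: df_smooth.
Qed.

Lemma smooth_omega c (A : 'M[R]_(2, n)) : atlas M c ->
  smooth_on (C c) (fun y => df omega c (lsubmx y) A).
Proof.
move=> ac; apply: (@smooth_on_cylinder _ _ _ (df omega c ^~ A)).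
  exact: open_ctarget.
exact: df_smooth.
Qed.

Lemma smooth_thick_form c A : atlas M c -> smooth_on (C c) (thick_form c ^~ A).
Proof.
move=> ac; have oC := @openC c; apply: smooth_onB => //; first exact: smooth_omega.
apply: (@smooth_on_eq _ _ _ _ (fun y =>
  'D_(row ord0 A) (thick_form1 c ^~ (row ord_max A)) y -
  'D_(row ord_max A) (thick_form1 c ^~ (row ord0 A)) y)) => //.
  by move=> y _; rewrite extd1E.
by apply: smooth_onB => //; apply: smooth_on_derive; exact: smooth_thick_form1.
Qed.

Lemma thick_form_bilinear2 c y : atlas M c -> C c y ->
  bilinear2 (thick_form c y) (fun u v => thick_form c y (pair_mx u v)).
Proof.
move=> ac cy.
have bo := form_bilinear2 (df_multilinear omega ac cy)
  (df_alternating omega ac cy).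
have be := extd1_bilinear2 (openC (c := c)) cy
  (fun v => smooth_thick_form1 v ac)
  (fun y cy a u v => thick_form1_linear a u v ac cy).
have [m a] := bilinear2_form (bilinear2B (bilinear2_lsubmx 1 bo) be).
exact: form_bilinear2.
Qed.

Lemma thick_form_closed c y A : closed_form omega -> atlas M c -> C c y ->
  extd (thick_form c) y A = 0.
Proof.
move=> co ac cy.
have dw (A' : 'M[R]_(2, n + 1)) : differentiable
    (fun z : 'rV[R]_(n + 1) => df omega c (lsubmx z) (lsubmx A')) y.
  have s := smooth_omega (lsubmx A') ac; exact: (smooth_on_differentiable s cy).
have de A' : differentiable (extd (thick_form1 c) ^~ A') y.
  have E : extd (thick_form1 c) ^~ A' =
      (fun z : 'rV[R]_(n + 1) => df omega c (lsubmx z) (lsubmx A')) -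
      thick_form c ^~ A'.
    by apply/funext => z; rewrite !fctE /thick_form opprB addrC subrK.
  rewrite E; apply: differentiableB => //.
  have s := smooth_thick_form A' ac; exact: (smooth_on_differentiable s cy).
rewrite (extdB (w := fun y (A' : 'M[R]_(2, n + 1)) => df omega c (lsubmx y) (lsubmx A')))//.
rewrite (extd_extd1 _ (openC (c := c)) cy) ?subr0; last first.
  by move=> v; exact: smooth_thick_form1.
rewrite (extd_lsubmx (w := df omega c)); first exact: co.
move=> A'; have s := df_smooth omega ac A'.
exact: (smooth_on_differentiable s (cy : ctarget c (lsubmx y))).
Qed.

Definition lift_jacobian c c' p : 'M[R]_(n + 1) :=
  block_mx (jacobian (transition c c') (cmap c p)) 0 0 1%:M.

Lemma lsubmx_mul_block k (A : 'M[R]_(k, n + 1)) (J : 'M[R]_n) :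
  lsubmx (A *m block_mx J 0 0 1%:M) = lsubmx A *m J.
Proof. by rewrite -{1}(hsubmxK A) mul_row_block row_mxKl mulmx0 addr0. Qed.

Lemma height_mul_block v (J : 'M[R]_n) :
  height (v *m block_mx J 0 0 1%:M) = height v.
Proof.
by rewrite /height -{1}(hsubmxK v) mul_row_block row_mxKr mulmx0 add0r mulmx1.
Qed.

Lemma lift_jacobianK c c' p : atlas M c -> atlas M c' -> cdom c p -> cdom c' p ->
  lift_jacobian c c' p *m lift_jacobian c' c p = 1%:M.
Proof.
move=> ac ac' cp c'p; rewrite /lift_jacobian mulmx_block.
rewrite jacobian_transitionK// !mulmx0 !mul0mx !addr0 !add0r mulmx1.
by rewrite -scalar_mx_block.
Qed.

Lemma lsubmx_slab_coord c (z : M * R) : lsubmx (slab_coord c z) = cmap c z.1.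
Proof. exact: row_mxKl. Qed.

Lemma height_slab_coord c (z : M * R) : height (slab_coord c z) = z.2.
Proof. exact: height_row_mx. Qed.

Lemma slab_coord_target c (z : M * R) : cdom c z.1 -> C c (slab_coord c z).
Proof. by move=> cz; rewrite /cylinder/= lsubmx_slab_coord; exact: ctarget_cmap. Qed.

(** Changes of lifted charts keep the height [s], hence carry [s alpha] to itself, and naturality of
    [extd] extends this to [d(s alpha)]. The point ranges over [M * R] because the thickened
    manifold is not yet available. *)
Lemma thick_form_transition c c' (z : M * R) A : atlas M c -> atlas M c' ->
  cdom c z.1 -> cdom c' z.1 ->
  thick_form c (slab_coord c z) A =
  thick_form c' (slab_coord c' z) (A *m lift_jacobian c c' z.1).
Proof.
move=> ac ac' cz c'z; rewrite /thick_form !lsubmx_slab_coord lsubmx_mul_block.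
rewrite (df_transition omega ac ac' cz c'z); congr (_ - _).
pose D := cmap c @` (cdom c `&` cdom c').
have oD : open D by apply: open_overlap; exact: cdom_open.
have st : smooth_on D (transition c c') := smooth_transition ac ac'.
have Dz : D (lsubmx (slab_coord c z)) by rewrite lsubmx_slab_coord; exists z.1.
have TE : suspension (transition c c') (slab_coord c z) = slab_coord c' z.
  by rewrite /suspension lsubmx_slab_coord height_slab_coord transition_cmap.
rewrite (@extd1_pullback _ _ _ (cylinder D) (C c') (thick_form1 c) (thick_form1 c')
  (suspension (transition c c')) (slab_coord c z) A
  (open_cylinder oD) (openC (c := c')))//.
- rewrite TE (jacobian_suspension oD st Dz) /lift_jacobian.
  by rewrite lsubmx_slab_coord.
- move=> y [q [cq c'q] qE]; rewrite /cylinder/= /suspension row_mxKl -qE.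
  by rewrite transition_cmap//; exact: ctarget_cmap.
- exact: smooth_on_suspension.
- by move=> v; exact: smooth_thick_form1.
- by move=> y cy a u v; exact: thick_form1_linear.
- move=> y Dy v; have [q [cq c'q] qE] := Dy.
  have dT := smooth_on_differentiable (smooth_on_suspension oD st) (Dy : cylinder D y).
  rewrite (deriveEjacobian _ dT) (jacobian_suspension oD st Dy).
  rewrite /thick_form1 lsubmx_mul_block /suspension row_mxKl height_row_mx.
  by rewrite -qE transition_cmap// (df_transition alpha ac ac' cq c'q).
Qed.

(** By the product rule [d(s alpha)] is the wedge of [ds] and [alpha] plus [s] times [d alpha], and
    the second term vanishes at [s = 0]. *)
Lemma thick_form_zero_section c p u v : atlas M c -> cdom c p ->
  thick_form c (slab_coord c (p, 0)) (pair_mx u v) =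
  df omega c (cmap c p) (pair_mx (lsubmx u) (lsubmx v)) -
  height u * df alpha c (cmap c p) (lsubmx v) +
  height v * df alpha c (cmap c p) (lsubmx u).
Proof.
move=> ac cp; have Cp := @slab_coord_target c (p, 0) cp.
have D a b : 'D_a (thick_form1 c ^~ b) (slab_coord c (p, 0)) =
    height a * df alpha c (cmap c p) (lsubmx b).
  have d1 : differentiable (height : 'rV[R]_(n + 1) -> R) (slab_coord c (p, 0)).
    exact: (smooth_on_differentiable (smooth_height openT) I).
  have d2 : differentiable (fun y : 'rV[R]_(n + 1) => df alpha c (lsubmx y) (lsubmx b))
      (slab_coord c (p, 0)).
    have s := smooth_on_cylinder (open_ctarget c) (df_smooth alpha ac (lsubmx b)).
    exact: (smooth_on_differentiable s Cp).
  rewrite [LHS](deriveM (diff_derivable d1) (diff_derivable d2)).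
  rewrite derive_height height_slab_coord lsubmx_slab_coord/= scale0r add0r.
  exact: mulrC.
rewrite /thick_form extd1E row0_pair row1_pair !D lsubmx_slab_coord/= opprB addrA.
rewrite addrAC; congr (_ - _ + _); congr (df omega c _ _).
have rl i (A : 'M[R]_(2, n + 1)) : row i (lsubmx A) = lsubmx (row i A).
  by apply/rowP => j; rewrite !mxE.
apply/row_matrixP => i; have [->|->] := ord2P i.
  by rewrite rl !row0_pair.
by rewrite rl !row1_pair.
Qed.

Lemma mul_pair_mx m k (u v : 'rV[R]_m) (J : 'M[R]_(m, k)) :
  pair_mx u v *m J = pair_mx (u *m J) (v *m J).
Proof. exact: (@mul_col_mx R 1 1 m k u v J). Qed.

Lemma eq_mx_form k (A B : 'M[R]_k) :
  (forall u v : 'rV[R]_k, (u *m A *m v^T) 0 0 = (u *m B *m v^T) 0 0) -> A = B.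
Proof.
move=> AB; apply/matrixP => i j; have := AB (delta_mx 0 i) (delta_mx 0 j).
by rewrite !trmx_delta -!rowE -!colE !mxE.
Qed.

Definition thick_gram c y : 'M[R]_(n + 1) :=
  gram (fun u v => thick_form c y (pair_mx u v)).

Lemma thick_gramE c y u v : atlas M c -> C c y ->
  thick_form c y (pair_mx u v) = (u *m thick_gram c y *m v^T) 0 0.
Proof. by move=> ac cy; exact: (gramE _ _ (thick_form_bilinear2 ac cy)). Qed.

Lemma thick_gram_transition c c' (z : M * R) : atlas M c -> atlas M c' ->
  cdom c z.1 -> cdom c' z.1 ->
  thick_gram c (slab_coord c z) =
  lift_jacobian c c' z.1 *m thick_gram c' (slab_coord c' z) *m
  (lift_jacobian c c' z.1)^T.
Proof.
move=> ac ac' cz c'z; apply: eq_mx_form => u v.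
rewrite -thick_gramE//; last exact: slab_coord_target.
rewrite (thick_form_transition _ ac ac')// mul_pair_mx thick_gramE//; last first.
  exact: slab_coord_target.
by rewrite trmx_mul !mulmxA.
Qed.

Lemma smooth_thick_gram c i j : atlas M c ->
  smooth_on (C c) (fun y => thick_gram c y i j).
Proof.
move=> ac; apply: (@smooth_on_eq _ _ _ _
  (thick_form c ^~ (pair_mx (delta_mx 0 i) (delta_mx 0 j)))).
- exact: openC.
- by move=> y _; rewrite mxE.
- exact: smooth_thick_form.
Qed.

(** The nondegeneracy locus of Lambda. One chart is enough in the definition: under a change of
    charts the Gram matrix becomes [J G J^T], so [thick_setP] recovers the condition in every
    chart. *)
Definition thick_set : set (M * R) :=
  [set z | exists c, [/\ atlas M c, cdom c z.1 &
                         \det (thick_gram c (slab_coord c z)) != 0]].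

Lemma thick_setP (z : M * R) c : thick_set z -> atlas M c -> cdom c z.1 ->
  \det (thick_gram c (slab_coord c z)) != 0.
Proof.
move=> [c' [ac' c'z d]] ac cz; move: d; rewrite (thick_gram_transition ac' ac)//.
by rewrite !det_mulmx; apply: contra => /eqP ->; rewrite mulr0 mul0r.
Qed.

Lemma open_thick_set : open thick_set.
Proof.
pose D c : set (M * R) := fst @^-1` (cdom c).
pose f c (z : M * R) := \det (thick_gram c (slab_coord c z)).
rewrite (_ : thick_set = \bigcup_(c in atlas M) (D c `&` (f c) @^-1` [set t | t != 0])).
  apply: bigcup_open => c ac; apply: open_setI_preimage.
  - apply: open_comp => [z _|]; [exact: cvg_fst|exact: cdom_open].
  - move=> z cz; apply: (@continuous_comp _ _ _ (slab_coord c)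
      (fun y => \det (thick_gram c y))).
      exact: continuous_slab_coord.
    have s : smooth_on (C c) (fun y => \det (thick_gram c y)).
      by apply: smooth_on_det => [|i j]; [exact: openC|exact: smooth_thick_gram].
    exact: (smooth_on_continuous s (slab_coord_target cz)).
  - exact: open_neq.
apply/seteqP; split=> z /=.
  by move=> [c [ac cz dz]]; exists c.
by move=> [c ac [cz dz]]; exists c; split.
Qed.

(** These four properties are all that is used of [i_X Omega] and of the 1-form, so the thickening
    is built for any [n]; only their verification for [i_X Omega] is three-dimensional. *)
Hypothesis omega_closed : closed_form omega.
Hypothesis alpha_X : forall c, atlas M c -> forall x, ctarget c x ->
  df alpha c x (X c x) = 1.
Hypothesis omega_X : forall c, atlas M c -> forall x, ctarget c x ->
  forall v : 'rV[R]_n, df omega c x (pair_mx (X c x) v) = 0.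
Hypothesis omega_ker : forall c, atlas M c -> forall x, ctarget c x ->
  forall u : 'rV[R]_n, df alpha c x u = 0 ->
  (forall v : 'rV[R]_n, df omega c x (pair_mx u v) = 0) -> u = 0.

(** A kernel vector [u] of the Gram matrix is tested against [X], the vertical unit vector and the
    horizontal vectors. This gives in turn that its height is 0, that [alpha] vanishes on its
    horizontal part, and that this part lies in the kernel of [omega]. *)
Lemma thick_set0 p : thick_set (p, 0).
Proof.
have [c ac cp] := atlas_cover p; exists c; split=> //; apply/negP => /det0P[u u0 uG].
have cx := ctarget_cmap cp; set x := cmap c p in cx.
have Cp := @slab_coord_target c (p, 0) cp.
have bo := form_bilinear2 (df_multilinear omega ac cx) (df_alternating omega ac cx).
have a0 : df alpha c x 0 = 0.
  have := form1_linear (-1) 0 0 ac cx; rewrite scaler0 addr0 mulN1r.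
  by rewrite addNr.
have Z v : df omega c x (pair_mx (lsubmx u) (lsubmx v)) -
    height u * df alpha c x (lsubmx v) + height v * df alpha c x (lsubmx u) = 0.
  by rewrite -thick_form_zero_section// thick_gramE// uG mul0mx mxE.
have hu : height u = 0.
  have := Z (row_mx (X c x) 0%:M); rewrite row_mxKl height_row_mx alpha_X// mul0r.
  rewrite (bilinear2_antisym _ _ bo) omega_X// oppr0 mulr1 addr0 sub0r.
  by move/eqP; rewrite oppr_eq0 => /eqP.
have au : df alpha c x (lsubmx u) = 0.
  have := Z (row_mx 0 1%:M); rewrite row_mxKl height_row_mx hu mul0r subr0 mul1r.
  have [_ _ Br _] := bo.
  have := Br (-1) (lsubmx u) 0 0; rewrite scaler0 addr0 mulN1r addNr => ->.
  by rewrite add0r.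
have lu : lsubmx u = 0.
  apply: (omega_ker ac cx au) => v; have := Z (row_mx v 0%:M).
  by rewrite row_mxKl height_row_mx hu !mul0r subr0 addr0.
move/eqP: u0; apply; rewrite -[u]row_mx_height hu lu raddf0.
exact: row_mx0.
Qed.

Local Notation W := (slab open_thick_set thick_set0).
Local Notation pc := (slab_chart open_thick_set thick_set0).

Lemma slab_target_coord c y : ctarget (pc c) y ->
  [/\ C c y, y = slab_coord c (cinv c (lsubmx y), height y) &
      thick_set (cinv c (lsubmx y), height y)].
Proof.
have -> : ctarget (pc c) = [set y | ctarget c (lsubmx y) /\
  thick_set (cinv c (lsubmx y), height y)] by exact: slab_targetE.
move=> [cy Wy]; split=> //.
by rewrite /slab_coord/= cinvK// row_mx_height.
Qed.

Lemma slab_target_sub c : ctarget (pc c) `<=` C c.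
Proof. by move=> y /slab_target_coord[]. Qed.

Lemma slab_target_gram c y : atlas M c -> ctarget (pc c) y ->
  \det (thick_gram c y) != 0.
Proof.
move=> ac /slab_target_coord[cy yE Wy]; rewrite yE.
exact: (thick_setP Wy ac (cdom_cinv cy)).
Qed.

Definition thick_rep : form_rep W 2 :=
  @slab_rep _ _ _ _ open_thick_set thick_set0 _ (fun _ _ => 0) thick_form.

Lemma thick_rep_multilinear (d : chart R (n + 1) W) : atlas W d ->
  forall y, ctarget d y -> Defs.multilinear (thick_rep d y).
Proof.
move=> /slab_atlasP[c [ac -> E]] y ty; rewrite /thick_rep E.
have [] // := bilinear2_form (thick_form_bilinear2 ac (slab_target_sub ty)).
Qed.

Lemma thick_rep_alternating (d : chart R (n + 1) W) : atlas W d ->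
  forall y, ctarget d y -> Defs.alternating (thick_rep d y).
Proof.
move=> /slab_atlasP[c [ac -> E]] y ty; rewrite /thick_rep E.
have [] // := bilinear2_form (thick_form_bilinear2 ac (slab_target_sub ty)).
Qed.

Lemma thick_rep_transition (d d' : chart R (n + 1) W) : atlas W d -> atlas W d' ->
  forall w, cdom d w -> cdom d' w -> forall A : 'M[R]_(2, n + 1),
  thick_rep d (cmap d w) A =
  thick_rep d' (cmap d' w) (A *m jacobian (transition d d') (cmap d w)).
Proof.
move=> /slab_atlasP[c [ac -> E]] /slab_atlasP[c' [ac' -> E']] w cw c'w A.
rewrite /thick_rep E E' slab_jacobian//.
exact: thick_form_transition.
Qed.

Lemma thick_rep_smooth (d : chart R (n + 1) W) : atlas W d ->
  forall A : 'M[R]_(2, n + 1), smooth_on (ctarget d) (fun y => thick_rep d y A).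
Proof.
move=> /slab_atlasP[c [ac -> E]] A; rewrite /thick_rep E.
apply: smooth_on_mono (smooth_thick_form A ac); exact: slab_target_sub.
Qed.

Definition thick_symplectic : diff_form W 2 :=
  DiffForm thick_rep_multilinear thick_rep_alternating thick_rep_transition
    thick_rep_smooth.

(** Nondegeneracy as a cancellation rule: a vector is known from its pairings with Lambda. It yields
    the nondegeneracy of the form, the transformation law of the Hamiltonian field and its value on
    the zero section. *)
Lemma thick_gram_inj c y u u' : atlas M c -> C c y ->
  \det (thick_gram c y) != 0 ->
  (forall v, thick_form c y (pair_mx u v) = thick_form c y (pair_mx u' v)) ->
  u = u'.
Proof.
move=> ac cy d uu'; have G : thick_gram c y \in unitmx by rewrite unitmxE unitfE.
apply: (can_inj (mulmxK G)); apply/rowP => j.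
have := uu' (delta_mx 0 j); rewrite !thick_gramE// trmx_delta -!colE.
by rewrite ![(col _ _) _ _]mxE.
Qed.

Lemma thick_symplecticP : symplectic thick_symplectic.
Proof.
split=> d /slab_atlasP[c [ac -> E]] y ty.
  move=> A; rewrite -[LHS]/(extd (thick_rep (pc c)) y A) /thick_rep E.
  by apply: thick_form_closed => //; exact: slab_target_sub.
move=> u; rewrite /= /thick_rep E => uv.
have cy := slab_target_sub ty.
apply: (thick_gram_inj ac cy (slab_target_gram ac ty)) => v.
rewrite [LHS]uv; have [_ Bl _ _] := thick_form_bilinear2 ac cy.
by have := Bl (-1) 0 0 v; rewrite scaler0 addr0 mulN1r addNr.
Qed.

(* The last row of the inverse Gram matrix is the field [Y] such that
   [i_Y Lambda] is the differential of the height. *)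
Definition thick_field c y : 'rV[R]_(n + 1) :=
  delta_mx 0 (rshift n ord0) *m invmx (thick_gram c y).

Lemma thick_fieldP c y v : atlas M c -> C c y -> \det (thick_gram c y) != 0 ->
  thick_form c y (pair_mx (thick_field c y) v) = height v.
Proof.
move=> ac cy d; have G : thick_gram c y \in unitmx by rewrite unitmxE unitfE.
rewrite thick_gramE// /thick_field mulmxKV// -rowE !mxE /height mxE.
by congr (v _ _).
Qed.

(** The field is characterised by [i_Y Lambda = ds], and Lambda and [s] are both invariant under
    changes of lifted charts, so inverse matrices need not be compared. *)
Lemma thick_field_transition c c' (z : M * R) : atlas M c -> atlas M c' ->
  cdom c z.1 -> cdom c' z.1 -> thick_set z ->
  thick_field c' (slab_coord c' z) =
  thick_field c (slab_coord c z) *m lift_jacobian c c' z.1.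
Proof.
move=> ac ac' cz c'z Wz.
have d := thick_setP Wz ac cz; have d' := thick_setP Wz ac' c'z.
have cy := slab_coord_target cz; have cy' := slab_coord_target c'z.
apply: (thick_gram_inj ac' cy' d') => v; rewrite thick_fieldP//.
(* Inserting a product of mutually inverse Jacobians writes [v] as the image of a vector in the
   chart [c], where the defining property of the field applies. *)
rewrite -[in RHS](mulmx1 v) -(lift_jacobianK ac' ac c'z cz) mulmxA -mul_pair_mx.
by rewrite -thick_form_transition// thick_fieldP// height_mul_block.
Qed.

(** Cramer's rule: each component is a cofactor of the Gram matrix divided by its determinant, which
    does not vanish on the target. *)
Lemma smooth_thick_field c : atlas M c -> smooth_on (ctarget (pc c)) (thick_field c).
Proof.
move=> ac; have oT : open (ctarget (pc c)) by exact: open_ctarget.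
have sG i j : smooth_on (ctarget (pc c)) (fun y => thick_gram c y i j).
  apply: smooth_on_mono (smooth_thick_gram i j ac); exact: slab_target_sub.
apply: smooth_on_rV => // j.
apply: (@smooth_on_eq _ _ _ _ (fun y => (\det (thick_gram c y))^-1 *
   cofactor (thick_gram c y) j (rshift n ord0))) => //.
  move=> y ty; have d := slab_target_gram ac ty.
  rewrite /thick_field -rowE mxE /invmx unitmxE unitfE d.
  by rewrite [RHS]mxE [in RHS]mxE.
apply: smooth_onM => //.
  apply: smooth_onV => //; first by move=> y; exact: slab_target_gram.
  exact: smooth_on_det.
apply: smooth_onM => //; first exact: smooth_on_cst.
apply: smooth_on_det => // i k.
apply: (@smooth_on_eq _ _ _ _ (fun y => thick_gram c y (lift j i) (lift (rshift n ord0) k))) => //.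
by move=> y _; rewrite !mxE.
Qed.

Definition field_rep : chart R (n + 1) W -> 'rV[R]_(n + 1) -> 'rV[R]_(n + 1) :=
  @slab_rep _ _ _ _ open_thick_set thick_set0 _ (fun=> 0) thick_field.

Lemma field_rep_transition (d d' : chart R (n + 1) W) : atlas W d -> atlas W d' ->
  forall w, cdom d w -> cdom d' w ->
  field_rep d' (cmap d' w) =
  field_rep d (cmap d w) *m jacobian (transition d d') (cmap d w).
Proof.
move=> /slab_atlasP[c [ac -> E]] /slab_atlasP[c' [ac' -> E']] w cw c'w.
rewrite /field_rep E E' slab_jacobian//.
by apply: thick_field_transition => //; exact: val_slab.
Qed.

Lemma field_rep_smooth (d : chart R (n + 1) W) : atlas W d ->
  smooth_on (ctarget d) (field_rep d).
Proof.
by move=> /slab_atlasP[c [ac -> E]]; rewrite /field_rep E; exact: smooth_thick_field.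
Qed.

Definition thick_vector_field : vector_field W :=
  VectorField field_rep_transition field_rep_smooth.

Definition slab_height (w : W) : R := (\val w).2.

Definition zero_section (p : M) : W := slab_pt (thick_set0 p).

Lemma slab_height_cinv c y : ctarget (pc c) y ->
  slab_height (cinv (pc c) y) = height y.
Proof. by move=> /slab_target_coord[_ _ Wy]; rewrite /slab_height /= slab_invE. Qed.

Lemma smooth_slab_height : smooth_function slab_height.
Proof.
move=> d /slab_atlasP[c [ac -> _]].
have oT : open (ctarget (pc c)) by exact: open_ctarget.
apply: (smooth_on_eq oT (f := height)); last exact: smooth_height.
by move=> y ty; rewrite /= slab_height_cinv.
Qed.

Lemma thick_hamiltonian : hamiltonian thick_symplectic thick_vector_field slab_height.
Proof.
move=> d /slab_atlasP[c [ac -> E]] y ty v.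
rewrite /interior_product /= /field_rep /thick_rep !E.
have cy := slab_target_sub ty.
rewrite [LHS](thick_fieldP v ac cy (slab_target_gram ac ty)).
rewrite /ext_derivative big_ord1 expr0 mul1r row_id -(derive_height y v).
apply: near_eq_derive; apply: (open_near (open_ctarget (pc c)) ty) => z tz.
by rewrite /function_form slab_height_cinv.
Qed.

Lemma range_zero_section : range zero_section = [set w | slab_height w = 0].
Proof.
apply/seteqP; split=> [_ [p _ <-]//|w w0].
by exists (\val w).1 => //; apply: val_inj; apply: injective_projections.
Qed.

Lemma continuous_zero_section : continuous zero_section.
Proof.
move=> p; apply: continuous_set_type.
exact: (@cvg_pair _ _ _ _ _ _ _ _ _ id (fun=> 0) cvg_id (cvg_cst _)).
Qed.

Lemma zero_section_local c c' :
  local_map zero_section c (pc c') = fun x => row_mx (transition c c' x) 0.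
Proof. by apply/funext => x; rewrite /local_map /= /slab_coord/= raddf0. Qed.

Lemma smooth_zero_section_local c c' : atlas M c -> atlas M c' ->
  smooth_on (cmap c @` (cdom c `&` cdom c')) (local_map zero_section c (pc c')).
Proof.
move=> ac ac'; rewrite zero_section_local; apply: smooth_on_row_mx.
- by apply: open_overlap; exact: cdom_open.
- exact: smooth_transition.
- exact: smooth_on_cst.
Qed.

Lemma jacobian_zero_section c c' p : atlas M c -> atlas M c' ->
  cdom c p -> cdom c' p ->
  jacobian (local_map zero_section c (pc c')) (cmap c p) =
  row_mx (jacobian (transition c c') (cmap c p)) 0.
Proof.
move=> ac ac' cp c'p.
have Dp : (cmap c @` (cdom c `&` cdom c')) (cmap c p) by exists p.
have d := smooth_on_differentiable (smooth_zero_section_local ac ac') Dp.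
have dt := differentiable_transition ac ac' cp c'p.
apply/row_matrixP => i; apply: (etrans (rowE _ _)).
apply: (etrans (esym (deriveEjacobian _ d))).
rewrite zero_section_local in d *.
rewrite (derive_row_mx _ dt (differentiable_cst _ _) d) derive_cst deriveEjacobian//.
by rewrite rowE mul_mx_row mulmx0.
Qed.

Lemma embedding_zero_section : embedding zero_section.
Proof.
split.
- split; first split; first exact: continuous_zero_section.
    move=> c d ac /slab_atlasP[c' [ac' -> _]].
    exact: smooth_zero_section_local.
  move=> c d ac /slab_atlasP[c' [ac' -> _]] p cp c'p.
  rewrite jacobian_zero_section//; apply/row_freeP.
  exists (col_mx (jacobian (transition c' c) (cmap c' p)) 0).
  by rewrite mul_row_col mul0mx addr0 jacobian_transitionK.
- by move=> p q /(congr1 (fun w : W => (\val w).1)).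
(* The projection to [M] is a continuous left inverse of the zero section. *)
- move=> V oV; exists ((fun w : W => (\val w).1) @^-1` V) => //.
  apply: open_comp => // w _; exact: continuous_val1.
Qed.

(** At [s = 0] the vector [(X, 0)] also contracts Lambda to [ds], since [i_X omega = 0] and
    [alpha(X) = 1]; nondegeneracy leaves no other choice. *)
Lemma thick_field_zero_section c p : atlas M c -> cdom c p ->
  thick_field c (slab_coord c (p, 0)) = row_mx (X c (cmap c p)) 0.
Proof.
move=> ac cp; have cy := @slab_coord_target c (p, 0) cp.
have d := thick_setP (thick_set0 p) ac cp.
have cx := ctarget_cmap cp.
apply: (thick_gram_inj ac cy d) => v; rewrite thick_fieldP// thick_form_zero_section//.
have -> : height (row_mx (X c (cmap c p)) 0) = 0 by rewrite /height row_mxKr mxE.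
by rewrite row_mxKl omega_X// alpha_X// mulr1 mul0r subr0 add0r.
Qed.

Lemma extends_zero_section : extends zero_section X thick_vector_field.
Proof.
move=> c d ac /slab_atlasP[c' [ac' -> E]] p cp c'p.
rewrite jacobian_zero_section// mul_mx_row mulmx0 -(vf_transition X ac ac')//.
rewrite /= /field_rep E.
exact: thick_field_zero_section.
Qed.

Theorem hamiltonian_thickening :
  exists (M' : smooth_manifold R (n + 1)) (Lambda : diff_form M' 2) (i : M -> M')
         (X' : vector_field M') (H : M' -> R),
    [/\ symplectic Lambda, embedding i, extends i X X',
        smooth_function H /\ hamiltonian Lambda X' H &
        exists c : R, range i = [set u | H u = c]].
Proof.
exists W, thick_symplectic, zero_section, thick_vector_field, slab_height; split.
- exact: thick_symplecticP.
- exact: embedding_zero_section.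
- exact: extends_zero_section.
- by split; [exact: smooth_slab_height|exact: thick_hamiltonian].
- by exists 0; exact: range_zero_section.
Qed.

End thickening.

(** * Three-dimensional linear algebra *)

Section three_forms.
Context {R : realType}.

Lemma eq_row' m n (A B : 'M[R]_(m.+1, n)) i :
  (forall j, j != i -> row j A = row j B) -> row' i A = row' i B.
Proof.
move=> AB; apply/matrixP => j k; rewrite !mxE.
have ji : lift i j != i by rewrite eq_sym neq_lift.
by have /rowP/(_ k) := AB _ ji; rewrite !mxE.
Qed.

Lemma row0_col_mx m n (u : 'rV[R]_n) (A : 'M[R]_(m, n)) :
  row ord0 (col_mx u A : 'M[R]_(1 + m, n)) = u.
Proof.
apply/rowP => j; rewrite mxE -(col_mxEu u A 0 j); congr (_ _ j).
exact: val_inj.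
Qed.

Lemma row_lift_col_mx m n (u : 'rV[R]_n) (A : 'M[R]_(m, n)) i :
  row (lift ord0 i) (col_mx u A : 'M[R]_(1 + m, n)) = row i A.
Proof.
apply/rowP => j; rewrite [LHS]mxE [RHS]mxE -(col_mxEd u A i j); congr (_ _ j).
exact: val_inj.
Qed.

Context {n : nat}.
Implicit Types a b c u v : 'rV[R]_n.

Definition triple_mx a b c : 'M[R]_(3, n) := col_mx a (pair_mx b c).

Let i1 : 'I_3 := lift ord0 ord0.
Let i2 : 'I_3 := lift ord0 ord_max.

Let ord3P (i : 'I_3) : [\/ i = ord0, i = i1 | i = i2].
Proof.
case: (unliftP ord0 i) => [j ->|->]; last exact: Or31.
by have [->|->] := ord2P j; [exact: Or32|exact: Or33].
Qed.

Let row_triple a b c : [/\ row ord0 (triple_mx a b c) = a,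
  row i1 (triple_mx a b c) = b & row i2 (triple_mx a b c) = c].
Proof.
by rewrite /triple_mx !row_lift_col_mx row0_col_mx row0_pair row1_pair.
Qed.

Lemma triple_row (A : 'M[R]_(3, n)) :
  triple_mx (row ord0 A) (row i1 A) (row i2 A) = A.
Proof.
have [r0 r1 r2] := row_triple (row ord0 A) (row i1 A) (row i2 A).
by apply/row_matrixP => i; have [->|->|->] := ord3P i.
Qed.

Context {w : 'M[R]_(3, n) -> R}.
Hypotheses (wM : Defs.multilinear w) (wA : Defs.alternating w).
Local Notation g a b c := (w (triple_mx a b c)).

Let wlin i (A B C : 'M[R]_(3, n)) s : row i A = s *: row i B + row i C ->
  (forall j, j != i -> row j B = row j A) ->
  (forall j, j != i -> row j C = row j A) -> w A = s * w B + w C.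
Proof.
move=> Ai Bj Cj; rewrite (wM (B := B) (C := C) (i := i) (b := s) (c := 1)) ?mul1r//.
- by rewrite scale1r.
- exact: eq_row'.
- exact: eq_row'.
Qed.

Lemma triple_linear1 s a a' b c : g (s *: a + a') b c = s * g a b c + g a' b c.
Proof.
have [r0 r1 r2] := row_triple (s *: a + a') b c.
have [p0 p1 p2] := row_triple a b c; have [q0 q1 q2] := row_triple a' b c.
apply: (@wlin ord0); first by rewrite r0 p0 q0.
- by move=> j; have [->|->|->] := ord3P j; rewrite ?eqxx ?p1 ?p2 ?r1 ?r2.
- by move=> j; have [->|->|->] := ord3P j; rewrite ?eqxx ?q1 ?q2 ?r1 ?r2.
Qed.

Lemma triple_linear2 s a b b' c : g a (s *: b + b') c = s * g a b c + g a b' c.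
Proof.
have [r0 r1 r2] := row_triple a (s *: b + b') c.
have [p0 p1 p2] := row_triple a b c; have [q0 q1 q2] := row_triple a b' c.
apply: (@wlin i1); first by rewrite r1 p1 q1.
- by move=> j; have [->|->|->] := ord3P j; rewrite ?eqxx ?p0 ?p2 ?r0 ?r2.
- by move=> j; have [->|->|->] := ord3P j; rewrite ?eqxx ?q0 ?q2 ?r0 ?r2.
Qed.

Lemma triple_linear3 s a b c c' : g a b (s *: c + c') = s * g a b c + g a b c'.
Proof.
have [r0 r1 r2] := row_triple a b (s *: c + c').
have [p0 p1 p2] := row_triple a b c; have [q0 q1 q2] := row_triple a b c'.
apply: (@wlin i2); first by rewrite r2 p2 q2.
- by move=> j; have [->|->|->] := ord3P j; rewrite ?eqxx ?p0 ?p1 ?r0 ?r1.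
- by move=> j; have [->|->|->] := ord3P j; rewrite ?eqxx ?q0 ?q1 ?r0 ?r1.
Qed.

Lemma triple_alt12 a c : g a a c = 0.
Proof.
by have [r0 r1 r2] := row_triple a a c; apply: (wA (i := ord0) (j := i1)); rewrite ?r0 ?r1.
Qed.

Lemma triple_alt23 a b : g a b b = 0.
Proof.
by have [r0 r1 r2] := row_triple a b b; apply: (wA (i := i1) (j := i2)); rewrite ?r1 ?r2.
Qed.

Lemma triple_alt13 a b : g a b a = 0.
Proof.
by have [r0 r1 r2] := row_triple a b a; apply: (wA (i := ord0) (j := i2)); rewrite ?r0 ?r2.
Qed.

Lemma triple_swap12 a b c : g b a c = - g a b c.
Proof.
have := triple_alt12 (1 *: a + b) c.
by rewrite triple_linear1 -(scale1r a) !triple_linear2 !scale1r !triple_alt12; lra.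
Qed.

Lemma triple_swap23 a b c : g a c b = - g a b c.
Proof.
have := triple_alt23 a (1 *: b + c).
by rewrite triple_linear2 -(scale1r b) !triple_linear3 !scale1r !triple_alt23; lra.
Qed.

Lemma interior_bilinear2 a :
  bilinear2 (fun A : 'M[R]_(2, n) => w (col_mx a A : 'M[R]_(1 + 2, n)))
            (fun b c => g a b c).
Proof.
split=> [A|s u u' v|s u v v'|u].
- by rewrite /triple_mx pair_row.
- exact: triple_linear2.
- exact: triple_linear3.
- exact: triple_alt23.
Qed.

(** After expansion in [a], [b], [c], every term either repeats an argument or is a permutation of
    [g a b c]. *)
Lemma triple_span_eq0 a b c u v t : g a b c = 0 ->
  (exists x y z, u = x *: a + (y *: b + z *: c)) ->
  (exists x y z, v = x *: a + (y *: b + z *: c)) ->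
  (exists x y z, t = x *: a + (y *: b + z *: c)) -> g u v t = 0.
Proof.
move=> g0 [x1 [y1 [z1 ->]]] [x2 [y2 [z2 ->]]] [x3 [y3 [z3 ->]]].
have gbac : g b a c = 0 by rewrite triple_swap12 g0 oppr0.
have gacb : g a c b = 0 by rewrite triple_swap23 g0 oppr0.
have gcab : g c a b = 0 by rewrite triple_swap12 gacb oppr0.
have gbca : g b c a = 0 by rewrite triple_swap23 gbac oppr0.
have gcba : g c b a = 0 by rewrite triple_swap12 gbca oppr0.
have L1 x y z v' t' : g (x *: a + (y *: b + z *: c)) v' t' =
    x * g a v' t' + (y * g b v' t' + z * g c v' t').
  rewrite !triple_linear1 -[z *: c]addr0 triple_linear1.
  have := triple_linear1 (-1) 0 0 v' t'; rewrite scaler0 addr0; lra.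
have L2 x y z u' t' : g u' (x *: a + (y *: b + z *: c)) t' =
    x * g u' a t' + (y * g u' b t' + z * g u' c t').
  rewrite !triple_linear2 -[z *: c]addr0 triple_linear2.
  have := triple_linear2 (-1) u' 0 0 t'; rewrite scaler0 addr0; lra.
have L3 x y z u' v' : g u' v' (x *: a + (y *: b + z *: c)) =
    x * g u' v' a + (y * g u' v' b + z * g u' v' c).
  rewrite !triple_linear3 -[z *: c]addr0 triple_linear3.
  have := triple_linear3 (-1) u' v' 0 0; rewrite scaler0 addr0; lra.
rewrite L1 !L2 !L3 g0 gbac gacb gcab gbca gcba.
by rewrite !triple_alt12 !triple_alt13 !triple_alt23 !(mulr0, addr0).
Qed.

End three_forms.

(** Contraposition. If [u] is non-zero, the values of [alpha] make [X] and [u] independent, and a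
    third vector [t] completes them to a basis. As [w] vanishes on this basis, it vanishes on all
    triples, in particular on the rows of [A]. *)
Lemma three_form_kernel (R : realType) (w : 'M[R]_(3, 3) -> R)
    (X u : 'rV[R]_3) (alpha : 'rV[R]_3 -> R) :
  Defs.multilinear w -> Defs.alternating w -> (exists A, w A != 0) ->
  (forall s a b, alpha (s *: a + b) = s * alpha a + alpha b) ->
  alpha X = 1 -> alpha u = 0 -> (forall v, w (triple_mx X u v) = 0) -> u = 0.
Proof.
move=> wM wA [A wA0] al aX au wXu; apply/eqP; apply: contraNT wA0 => u0.
have a0 : alpha 0 = 0.
  by have := al (-1) 0 0; rewrite scaler0 addr0; lra.
have XuE (x y : R) : x *: X + y *: u = 0 -> x = 0 /\ y = 0.
  move=> E; have x0 : x = 0.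
    by have := al x X (y *: u); rewrite E a0 aX -[_ *: u]addr0 al au a0; lra.
  split=> //; move: E; rewrite x0 scale0r add0r => /eqP.
  by rewrite scaler_eq0 (negbTE u0) orbF => /eqP.
pose S := pair_mx X u.
have SE (k : 'rV[R]_2) : k *m S = k 0 ord0 *: X + k 0 ord_max *: u.
  rewrite mulmx_sum_row big_ord_recr big_ord1/= -/S.
  rewrite (_ : widen_ord _ _ = ord0); last exact: val_inj.
  by rewrite row0_pair row1_pair.
(* The span of [X] and [u] has rank at most 2, so it cannot contain all three standard basis
   vectors; one that it misses becomes [t]. *)
have [i nSi] : exists i, ~~ (row i (1%:M : 'M[R]_3) <= S)%MS.
  apply/existsP; rewrite -negb_forall; apply/negP => /forallP all.
  have /mxrankS : ((1%:M : 'M[R]_3) <= S)%MS by apply/row_subP.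
  by rewrite mxrank1 leqNgt ltnS rank_leq_row.
set t := row i 1%:M in nSi.
pose B : 'M[R]_3 := triple_mx X u t.
pose i1 : 'I_3 := lift ord0 ord0; pose i2 : 'I_3 := lift ord0 ord_max.
have BE (k : 'rV[R]_3) : k *m B = k 0 ord0 *: X + (k 0 i1 *: u + k 0 i2 *: t).
  rewrite mulmx_sum_row big_ord_recl big_ord_recl big_ord1 /B /triple_mx.
  rewrite row0_col_mx !row_lift_col_mx row0_pair.
  rewrite (_ : lift ord0 (lift ord0 ord0) = i2); last exact: val_inj.
  by rewrite row_id.
have unitB : B \in unitmx.
  rewrite -row_free_unit; apply: inj_row_free => k; rewrite BE => E.
  have k2 : k 0 i2 = 0.
    apply/eqP; apply: contraNT nSi => k2.
    (* The coefficients obtained by solving the linear relation for [t], whose coefficient is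
       assumed non-zero. *)
    apply/submxP; exists (- (k 0 i2)^-1 *: \row_(j < 2) (if j == ord0 then k 0 ord0 else k 0 i1)).
    rewrite -scalemxAl SE !mxE /=.
    have -> : k 0 ord0 *: X + k 0 i1 *: u = - (k 0 i2 *: t).
      by apply/eqP; rewrite -addr_eq0 -addrA E.
    by rewrite scalerN scaleNr opprK scalerA mulVf// scale1r.
  move: E; rewrite k2 scale0r addr0 => /XuE[k0 k1].
  apply/rowP => j; rewrite mxE; case: (unliftP ord0 j) => [l|] -> //.
  by have [->|->] := ord2P l.
have rowE' j : exists x y z, row j A = x *: X + (y *: u + z *: t).
  have E : row j A = row j (A *m invmx B) *m B by rewrite -row_mul mulmxKV.
  by rewrite E BE; do 3!eexists.
rewrite -(triple_row A); apply/eqP.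
by apply: (triple_span_eq0 wM wA (wXu t)).
Qed.

(** * The closed 2-form obtained by contracting the volume form with X *)

Section interior_form.
Context {R : realType} {M : smooth_manifold R 3}.
Context (Omega : diff_form M 3) (X : vector_field M).

Let form : form_rep M 2 := interior_product X (df Omega).

Lemma interior_formE c x A : form c x A = df Omega c x (col_mx (X c x) A : 'M[R]_(1 + 2, 3)).
Proof. by []. Qed.

Let form_bilinear2 c x : atlas M c -> ctarget c x ->
  bilinear2 (form c x) (fun u v => df Omega c x (triple_mx (X c x) u v)).
Proof.
move=> ac cx.
exact: (interior_bilinear2 (df_multilinear Omega ac cx) (df_alternating Omega ac cx)).
Qed.

(** Vanishing divergence says that [d(i_X Omega)] is [0 * Omega], so closedness is immediate; the
    contraction still has to be shown to be a smooth form. *)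
Lemma interior_form_exists : divergence_free Omega X ->
  exists2 omega : diff_form M 2, closed_form omega &
  forall c x A, df omega c x A = df Omega c x (col_mx (X c x) A : 'M[R]_(1 + 2, 3)).
Proof.
move=> divX.
have fM c : atlas M c -> forall x, ctarget c x -> Defs.multilinear (form c x).
  by move=> ac x cx; have [] := bilinear2_form (form_bilinear2 ac cx).
have fA c : atlas M c -> forall x, ctarget c x -> Defs.alternating (form c x).
  by move=> ac x cx; have [] := bilinear2_form (form_bilinear2 ac cx).
have fT c c' : atlas M c -> atlas M c' -> forall p, cdom c p -> cdom c' p ->
    forall A : 'M[R]_(2, 3), form c (cmap c p) A =
    form c' (cmap c' p) (A *m jacobian (transition c c') (cmap c p)).
  move=> ac ac' p cp c'p A; rewrite !interior_formE.
  rewrite (df_transition Omega ac ac' cp c'p) (vf_transition X ac ac' cp c'p).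
  by congr (df Omega c' _ _); exact: (@mul_col_mx R 1 2 3 3).
have fS c : atlas M c -> forall A : 'M[R]_(2, 3),
    smooth_on (ctarget c) (fun x => form c x A).
  move=> ac A; have oc := open_ctarget c.
  (* [df_smooth] speaks of constant arguments only, so the varying first row [X c x] is expanded in
     the standard basis. *)
  apply: (@smooth_on_eq _ _ _ _ (fun x => \sum_j X c x 0 j *
    df Omega c x (triple_mx (delta_mx 0 j) (row ord0 A) (row ord_max A)))) => //.
    move=> x cx; have [-> _ _ _] := form_bilinear2 ac cx.
    have L s a a' b d := triple_linear1 (df_multilinear Omega ac cx) s a a' b d.
    rewrite {2}(row_sum_delta (X c x)); elim: (index_enum _) => [|j r IH].
      rewrite !big_nil; have := L (-1) 0 0 (row ord0 A) (row ord_max A).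
      by rewrite scaler0 addr0; lra.
    by rewrite !big_cons L IH.
  apply: smooth_on_sum => // j _; apply: smooth_onM => //; last exact: df_smooth.
  by apply: smooth_on_coord => //; exact: vf_smooth.
exists (DiffForm fM fA fT fS) => // c ac x cx v.
by apply: (etrans (divX c ac x cx v)); rewrite /function_mul mul0r.
Qed.

End interior_form.

Theorem theorem1 (R : realType) (M : smooth_manifold R 3)
    (Omega : diff_form M 3) (X : vector_field M) :
  oriented M -> volume_form Omega -> divergence_free Omega X ->
  (exists N : set M, global_cross_section X N) ->
  exists (M' : smooth_manifold R 4) (Lambda : diff_form M' 2) (i : M -> M')
         (X' : vector_field M') (H : M' -> R),
    [/\ symplectic Lambda, embedding i, extends i X X',
        smooth_function H /\ hamiltonian Lambda X' H &
        exists c : R, range i = [set u | H u = c]].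
Proof.
move=> _ vol divX [N crossN].
have [alpha alphaX] := unit_form_exists (cross_section_nonvanishing crossN).
have [omega closed_omega omegaE] := interior_form_exists divX.
(* The thickening has dimension [3 + 1], which is convertible to 4. *)
apply: (@hamiltonian_thickening R 3 M omega alpha X) => //.
- move=> c ac x cx v; rewrite omegaE.
  exact: (triple_alt12 (df_alternating Omega ac cx)).
- move=> c ac x cx u au uv.
  have al s a b := @form1_linear R 3 M alpha c x s a b ac cx.
  have wXu v : df Omega c x (triple_mx (X c x) u v) = 0 by rewrite -(uv v) omegaE.
  exact: (three_form_kernel (df_multilinear Omega ac cx)
    (df_alternating Omega ac cx) (vol c ac x cx) al (alphaX c ac x cx) au wXu).
Qed.
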